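(* Let $d\ge1$, $\alpha\in(0,2]$, $p\in(0,1)$ with $\alpha p<1$, and let $t\in\mathbb{R}_+=[0,\infty)$. Let $(S_n)_{n\ge0}$ be the $d$-dimensional Shark Random Swim with memory parameter $p$ and stability parameter $\alpha$. Then, as $n\to\infty$, $$\left(\frac1n\right)^{1/\alpha}S_{\lfloor tn\rfloor}\longrightarrow t^{1/\alpha}S\quad\text{in distribution},$$ where $S$ is a $d$-dimensional isotropic $\alpha$-stable random variable with zero shift and scale parameter $c(\alpha,p)^{1/\alpha}$, that is $$\mathbb{E}\left[e^{i\langle\theta,S\rangle}\right]=\exp\left(-c(\alpha,p)\,\|\theta\|^\alpha\right),\qquad\theta\in\mathbb{R}^d .$$
   Context: Let $\xi_1,\xi_2,\dots$ be i.i.d. $\mathbb{R}^d$-valued random variables that are standard isotropic strictly $\alpha$-stable: $\mathbb{E}[e^{i\langle\theta,\xi_1\rangle}]=e^{-\|\theta\|^\alpha}$ for all $\theta\in\mathbb{R}^d$, with $\|\cdot\|$ the Euclidean norm. The Shark Random Swim is defined by steps $Y_1=\xi_1$ and, for $n\ge2$: with probability $p$, an index $U_n$ is chosen uniformly in $\{1,\dots,n-1\}$ and $Y_n=Y_{U_n}$; with probability $1-p$, $Y_n=\xi_n$. All these random choices are independent of each other and of the $\xi_i$. Set $S_0=0$ and $S_n=\sum_{i=1}^nY_i$. The constant $c(\alpha,p)$ is $$c(\alpha,p)=\int_0^{1-p}f(x)\,dx,\qquad f(x)=\sum_{k=1}^\infty k^\alpha\left(1-\left(\tfrac{x}{1-p}\right)^p\right)^{k-1}\left(\tfrac{x}{1-p}\right)^p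 ,$$ i.e. $f(x)=\mathbb{E}[G^\alpha]$ with $G$ geometric on $\{1,2,\dots\}$ with parameter $(x/(1-p))^p$; this integral is finite when $\alpha p<1$. *)

(* Defs.v *)
(* MathComp-Analysis; complex numbers R[i] from mathcomp-real-closed. *)
From HB Require Import structures.
From mathcomp Require Import all_boot all_order all_algebra finmap.
From mathcomp Require Import complex.
From mathcomp Require Import all_classical all_reals all_analysis.

Set Implicit Arguments.
Unset Strict Implicit.
Unset Printing Implicit Defensive.

Import Order.TTheory GRing.Theory Num.Theory.
Import numFieldNormedType.Exports.

Local Open Scope classical_set_scope.
Local Open Scope ring_scope.

(* Borel sigma-algebra on matrices, in particular on R^d = 'rV[R]_d. *)
HB.instance Definition _ (R : realType) (m n : nat) :=
  @isMeasurable.Build (sigma_display (@open 'M[R]_(m, n))) 'M[R]_(m, n)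
    <<s @open 'M[R]_(m, n) >>
    (@sigma_algebra0 _ setT (@open 'M[R]_(m, n)))
    (@sigma_algebraC _ (@open 'M[R]_(m, n)))
    (@sigma_algebra_bigcup _ setT (@open 'M[R]_(m, n))).

Definition dotp (R : realType) (d : nat) (u v : 'rV[R]_d) : R :=
  \sum_(i < d) u ord0 i * v ord0 i.

(* Euclidean norm; the library norm `|u| on 'rV[R]_d is the sup norm. *)
Definition enorm (R : realType) (d : nat) (u : 'rV[R]_d) : R :=
  Num.sqrt (dotp u u).

(* E[exp(i <theta, X>)]: the expectation of a complex random variable is taken
   on its real and imaginary parts. *)
Definition charfun (R : realType) (disp : measure_display)
    (T : measurableType disp) (P : probability T R) (d : nat)
    (X : {RV P >-> 'rV[R]_d}) (theta : 'rV[R]_d) : R[i] :=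
  ((\int[P]_w cos (dotp theta (X w))) +i*
   (\int[P]_w sin (dotp theta (X w))))%C.

(* The random vectors are passed as plain functions, so that sums and scalings
   can be written directly; their measurability is part of the definition. *)
Definition cvg_in_distribution (R : realType) (disp disp' : measure_display)
    (T : measurableType disp) (T' : measurableType disp')
    (P : probability T R) (Q : probability T' R) (d : nat)
    (X : nat -> T -> 'rV[R]_d) (Z : T' -> 'rV[R]_d) : Prop :=
  [/\ forall n, measurable_fun [set: T] (X n),
      measurable_fun [set: T'] Z &
      forall f : 'rV[R]_d -> R,
        continuous f -> (exists M : R, forall x, `|f x| <= M) ->
        (fun n => \int[P]_w f (X n w)) @ \oo --> \int[Q]_w f (Z w)].

(* Mutual independence of the classes of events F i, for i in D. *)
Definition mutually_independent (R : realType) (disp : measure_display)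
    (T : measurableType disp) (P : probability T R) (I : choiceType)
    (D : set I) (F : I -> set_system T) : Prop :=
  forall (J : {fset I}) (E : I -> set T),
    [set` J] `<=` D -> (forall i, i \in J -> F i (E i)) ->
    fine (P (\bigcap_(i in [set` J]) E i)) = \prod_(i <- J) fine (P (E i)).

(* The steps xi, the coins and the indices U together form one family, indexed
   by (nat + nat) + nat; swim_index keeps xi_i for i >= 1 and the coins and
   indices of the times n >= 2. *)
Definition swim_index : set ((nat + nat) + nat) :=
  [set k | match k with
           | inl (inl i) => (1 <= i)%N
           | inl (inr n) => (2 <= n)%N
           | inr n => (2 <= n)%N
           end].

Definition swim_events (R : realType) (disp : measure_display)
    (T : measurableType disp) (P : probability T R) (d : nat)
    (xi : nat -> {RV P >-> 'rV[R]_d}) (coin : nat -> {RV P >-> bool})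
    (U : nat -> {RV P >-> nat}) (k : (nat + nat) + nat) : set_system T :=
  match k with
  | inl (inl i) => g_sigma_algebra_preimage (xi i)
  | inl (inr n) => g_sigma_algebra_preimage (coin n)
  | inr n => g_sigma_algebra_preimage (U n)
  end.

(* Y is the sequence of steps of the swim driven by xi, coin and U; the event
   coin n = true is the one on which the n-th step repeats a past step. The
   values xi 0, Y 0, coin 0, coin 1, U 0 and U 1 are irrelevant. *)
Record shark_random_swim (R : realType) (disp : measure_display)
    (T : measurableType disp) (P : probability T R) (d : nat) (alpha p : R)
    (xi : nat -> {RV P >-> 'rV[R]_d}) (coin : nat -> {RV P >-> bool})
    (U : nat -> {RV P >-> nat}) (Y : nat -> {RV P >-> 'rV[R]_d}) : Prop := {
  swim_xi_ident : forall i, (1 <= i)%N -> forall A, measurable A ->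
    distribution P (xi i) A = distribution P (xi 1%N) A ;
  swim_xi_charfun : forall theta,
    charfun (xi 1%N) theta = ((expR (- (enorm theta `^ alpha)))%:C)%C ;
  swim_coin : forall n, (2 <= n)%N -> P (coin n @^-1` [set true]) = p%:E ;
  swim_uniform : forall n, (2 <= n)%N -> forall k, (1 <= k < n)%N ->
    P (U n @^-1` [set k]) = (n.-1%:R^-1)%:E ;
  swim_indep : mutually_independent P swim_index (swim_events xi coin U) ;
  swim_Y1 : {ae P, forall w, Y 1%N w = xi 1%N w} ;
  swim_YS : forall n, (2 <= n)%N ->
    {ae P, forall w, Y n w = if coin n w then Y (U n w) w else xi n w}
}.

Definition swim_position (R : realType) (T : Type) (d : nat)
    (Y : nat -> T -> 'rV[R]_d) (n : nat) (w : T) : 'rV[R]_d :=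
  \sum_(1 <= i < n.+1) Y i w.

(* E[G^alpha], for G geometric on {1, 2, ...} with parameter (x / (1 - p))^p. *)
Definition geom_moment (R : realType) (alpha p x : R) : \bar R :=
  let q := (x / (1 - p)) `^ p in
  (\sum_(1 <= k <oo) (k%:R `^ alpha * (1 - q) ^+ k.-1 * q)%R%:E)%E.

(* The integral is finite when alpha * p < 1. *)
Definition swim_const (R : realType) (alpha p : R) : R :=
  fine (\int[lebesgue_measure]_(x in `[0%R, (1 - p)%R]) geom_moment alpha p x)%E.

(* Main.v *)
Require Import Defs.
From HB Require Import structures.
From mathcomp Require Import all_boot all_order all_algebra finmap.
From mathcomp Require Import complex ring lra.
From mathcomp Require Import all_classical all_reals all_analysis.
From mathcomp Require Import measurable_realfun.

(** The argument conditions on the memory.  Given the coins and the choices, a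
    step is a copy of some xi_j; call j its label, so that S_n is the sum of the
    xi_j weighted by the number of steps labelled j, the size of the cluster of
    j.  Since the xi_j are independent of the memory and isotropic stable,
<<
      E exp(i <theta, S_n>) = E exp(- |theta|^alpha A_n),
      A_n = sum over the clusters of (size)^alpha,
>>
    ([swim_charfun]), and everything reduces to the law of large numbers
    A_n / n --> c(alpha, p) ([swim_lln]).

    The law of the labels is that of a Markov chain on finite lists: a new label
    is added with probability 1 - p, and otherwise the label of a uniformly
    chosen earlier step is repeated.  Expectations for this chain are computed by
    a recursive operator, [swim_mean], which involves no measure theory; the
    recursion is tied to the probability space in [swim_mean_recursion], by
    splitting on the coin and the choice made at the last step.

    For the law of large numbers, the number N_k of clusters of size k satisfies
    N_k / n --> a_k in mean square, by induction on k, where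
<<
      (1 + p k) a_k = p (k - 1) a_(k - 1) + (1 - p) [k = 1]
>>
    ([clusters_lln]).  Large clusters are negligible: as alpha p < 1, some
    b > alpha has b p < 1, and then the sum of (size)^b has a mean of order n
    ([swim_moment_le]).  So A_n / n tends to the sum of the k^alpha a_k, which is
    c(alpha, p) because the a_k are the integrals of the geometric weights in its
    definition: these integrals obey the same recursion, by the fundamental
    theorem of calculus ([swim_constE]).

    It remains to pass from characteristic functions to laws
    ([cvg_in_distribution_charfun]).  On a box, a continuous function is
    uniformly close to a trigonometric polynomial with the same bound
    ([trig_approx]), and the mass outside the box is small uniformly in n: here
    1 - E cos(s <e_i, X_n>) <= C s^alpha, which controls the dyadic shells of the
    coordinates ([tight_of_cos]). *)

Set Implicit Arguments.
Unset Strict Implicit.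
Unset Printing Implicit Defensive.

Import Order.TTheory GRing.Theory Num.Theory.
Import numFieldNormedType.Exports.

Local Open Scope classical_set_scope.
Local Open Scope ring_scope.

(** * The chain of labels *)

Section ClusterChain.
Variables (R : realType) (p : R).

(** The expectation of [F] under the law of the labels of the first [n.+1] steps,
    listed from the newest to the oldest; a fresh label is the time at which it
    appears.  Summing over the entries [x <- r] is choosing a past step. *)
Fixpoint swim_mean (n : nat) (F : seq nat -> R) : R :=
  if n is m.+1 then
    swim_mean m (fun r =>
      (1 - p) * F (m.+2 :: r) + p / m.+1%:R * \sum_(x <- r) F (x :: r))
  else F [:: 1%N].

Definition labelling (n : nat) (r : seq nat) : bool :=
  (size r == n.+1) && all (fun x => 0 < x <= n.+1)%N r.

Lemma labelling_new n r : labelling n r -> labelling n.+1 (n.+2 :: r).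
Proof.
move=> /andP[/eqP sr /allP ar]; rewrite /labelling /= sr eqxx leqnn /=.
by apply/allP => x /ar /andP[-> /= /leq_trans]; apply.
Qed.

Lemma labelling_copy n r x : labelling n r -> x \in r -> labelling n.+1 (x :: r).
Proof.
move=> /andP[/eqP sr /allP ar] xr; rewrite /labelling /= sr eqxx /=.
have /andP[-> /= xn] := ar _ xr; rewrite (leq_trans xn) //=.
by apply/allP => y /ar /andP[-> /= /leq_trans]; apply.
Qed.

Lemma labelling_fresh n r : labelling n r -> n.+2 \notin r.
Proof.
by move=> /andP[_ /allP ar]; apply/negP => /ar /andP[_]; rewrite ltnn.
Qed.

Hypothesis p01 : 0 < p < 1.

Let p_ge0 : 0 <= p. Proof. by case/andP: p01 => /ltW. Qed.
Let p_le1 : p <= 1. Proof. by case/andP: p01 => _ /ltW. Qed.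

Lemma ler_swim_mean n F G : (forall r, labelling n r -> F r <= G r) ->
  swim_mean n F <= swim_mean n G.
Proof.
elim: n F G => [|n IH] F G FG /=; first exact: FG.
apply: IH => r lr; apply: lerD.
  by rewrite ler_wpM2l ?subr_ge0 // FG // labelling_new.
rewrite ler_wpM2l ?divr_ge0 // big_seq [leRHS]big_seq.
by apply: ler_sum => x xr; rewrite FG // labelling_copy.
Qed.

Lemma eq_swim_mean n F G : (forall r, labelling n r -> F r = G r) ->
  swim_mean n F = swim_mean n G.
Proof.
by move=> FG; apply/eqP; rewrite eq_le !ler_swim_mean // => r /FG ->.
Qed.

Lemma swim_meanD n F G :
  swim_mean n (fun r => F r + G r) = swim_mean n F + swim_mean n G.
Proof.
elim: n F G => [//|n IH] F G /=; rewrite -IH; apply: eq_swim_mean => r _.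
by rewrite big_split /=; ring.
Qed.

Lemma swim_meanZ n c F : swim_mean n (fun r => c * F r) = c * swim_mean n F.
Proof.
elim: n F => [//|n IH] F /=; rewrite -IH; apply: eq_swim_mean => r _.
by rewrite -big_distrr /=; ring.
Qed.

Lemma swim_mean_cst n c : swim_mean n (fun=> c) = c.
Proof.
elim: n c => [//|n IH] c /=; rewrite -[RHS](IH c).
apply: eq_swim_mean => r /andP[/eqP sr _].
rewrite big_const_seq count_predT sr iter_addr_0 -[c *+ _]mulr_natr.
have n0 : n.+1%:R != 0 :> R by rewrite pnatr_eq0.
by move: n.+1%:R n0 => N n0; field.
Qed.

Lemma swim_mean_sum n (I : Type) (s : seq I) (F : I -> seq nat -> R) :
  swim_mean n (fun r => \sum_(i <- s) F i r) = \sum_(i <- s) swim_mean n (F i).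
Proof.
elim: s => [|i s IH].
  by rewrite big_nil -[RHS](swim_mean_cst n); apply: eq_swim_mean => r _; rewrite big_nil.
rewrite big_cons -IH -swim_meanD; apply: eq_swim_mean => r _.
by rewrite big_cons.
Qed.

(** The increment of an expectation is the expectation of the conditional mean
    increment; all the estimates on the chain are recursions of this form. *)
Lemma swim_meanS n F : swim_mean n.+1 F = swim_mean n F +
  swim_mean n (fun r => (1 - p) * (F (n.+2 :: r) - F r) +
                        p / n.+1%:R * \sum_(x <- r) (F (x :: r) - F r)).
Proof.
rewrite -swim_meanD /=; apply: eq_swim_mean => r /andP[/eqP sr _].
rewrite big_split /= big_const_seq count_predT sr iter_addr_0 -[(- F r) *+ _]mulr_natr.
have n0 : n.+1%:R != 0 :> R by rewrite pnatr_eq0.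
by move: n.+1%:R n0 => N n0; field.
Qed.

End ClusterChain.

(** * Sums over clusters *)

Section ClusterSums.
Variable R : realType.
Implicit Types (f g : nat -> R) (r : seq nat).

Definition cluster_sum f r : R := \sum_(x <- undup r) f (count_mem x r).

Lemma cluster_sum_new f r y : y \notin r ->
  cluster_sum f (y :: r) = f 1%N + cluster_sum f r.
Proof.
move=> yr; rewrite /cluster_sum /= (negbTE yr) big_cons eqxx (count_memPn yr) addn0.
congr (_ + _); apply: eq_big_seq => x; rewrite mem_undup => xr.
by rewrite (_ : (y == x) = false) //; apply/negbTE; apply: contraNneq yr => ->.
Qed.

Lemma cluster_sum_copy f r y : y \in r ->
  cluster_sum f (y :: r) =
  cluster_sum f r + (f (count_mem y r).+1 - f (count_mem y r)).
Proof.
move=> yr; rewrite /cluster_sum /= yr.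
rewrite [in RHS](bigD1_seq y) ?mem_undup ?undup_uniq //=.
rewrite (bigD1_seq y) ?mem_undup ?undup_uniq //= eqxx add1n.
rewrite (eq_bigr (fun x => f (count_mem x r))); first by ring.
by move=> x /negbTE; rewrite eq_sym => ->.
Qed.

Lemma sum_labels (h : nat -> R) r :
  \sum_(x <- r) h x = \sum_(x <- undup r) (count_mem x r)%:R * h x.
Proof.
elim: r => [|y r IH]; first by rewrite !big_nil.
rewrite big_cons IH /=; case: ifPn => yr; last first.
  rewrite big_cons eqxx (count_memPn yr) mul1r; congr (_ + _).
  apply: eq_big_seq => x; rewrite mem_undup => xr.
  by rewrite (_ : (y == x) = false) //; apply/negbTE; apply: contraNneq yr => ->.
rewrite (bigD1_seq y) ?mem_undup ?undup_uniq //=.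
rewrite [RHS](bigD1_seq y) ?mem_undup ?undup_uniq //= eqxx add1n -natr1.
rewrite [in RHS](eq_bigr (fun x => (count_mem x r)%:R * h x)); first by ring.
by move=> x /negbTE; rewrite eq_sym => ->.
Qed.

(** A cluster of size k is chosen k times when the past steps are enumerated,
    and it then contributes f (k + 1) - f k. *)
Lemma cluster_sum_drift f r :
  \sum_(x <- r) (cluster_sum f (x :: r) - cluster_sum f r) =
  cluster_sum (fun k => k%:R * (f k.+1 - f k)) r.
Proof.
transitivity (\sum_(x <- r) (f (count_mem x r).+1 - f (count_mem x r))).
  by apply: eq_big_seq => x xr; rewrite cluster_sum_copy //; ring.
exact: sum_labels.
Qed.

(** The clusters partition the steps. *)
Lemma cluster_sum_size r : cluster_sum (fun k => k%:R) r = (size r)%:R.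
Proof.
have := sum_labels (fun=> 1) r; rewrite /cluster_sum.
under [in RHS]eq_bigr do rewrite mulr1.
by move=> <-; rewrite big_const_seq count_predT iter_addr_0.
Qed.

Lemma ler_cluster_sum f g r : (forall k, (0 < k <= size r)%N -> f k <= g k) ->
  cluster_sum f r <= cluster_sum g r.
Proof.
move=> fg; rewrite /cluster_sum big_seq [leRHS]big_seq.
apply: ler_sum => x; rewrite mem_undup => xr; apply: fg.
by rewrite count_size andbT -has_count has_pred1.
Qed.

Lemma eq_cluster_sum f g r : (forall k, (0 < k)%N -> f k = g k) ->
  cluster_sum f r = cluster_sum g r.
Proof.
by move=> fg; apply/eqP; rewrite eq_le !ler_cluster_sum // => k /andP[/fg -> _].
Qed.

Lemma cluster_sumD f g r :
  cluster_sum (fun k => f k + g k) r = cluster_sum f r + cluster_sum g r.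
Proof. exact: big_split. Qed.

Lemma cluster_sumZ c f r : cluster_sum (fun k => c * f k) r = c * cluster_sum f r.
Proof. by rewrite /cluster_sum big_distrr. Qed.

Lemma cluster_sum_ge0 f r : (forall k, (0 < k)%N -> 0 <= f k) -> 0 <= cluster_sum f r.
Proof.
move=> f0; rewrite (_ : 0 = cluster_sum (fun=> 0) r).
  by apply: ler_cluster_sum => k /andP[/f0].
by rewrite /cluster_sum big1.
Qed.

End ClusterSums.

(** * Asymptotic frequencies of the cluster sizes *)

Section ClusterCount.
Variables (R : realType) (p : R).
Hypothesis p01 : 0 < p < 1.

Let p_gt0 : 0 < p. Proof. by case/andP: p01. Qed.
Let p_lt1 : p < 1. Proof. by case/andP: p01. Qed.

(** The solution of the stationary equation of the mean cluster counts: a cluster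
    reaches size k + 1 at rate p k a_k and leaves it at rate p (k + 1) a_(k + 1). *)
Fixpoint cluster_freq (k : nat) : R :=
  if k is j.+1 then
    (p * j%:R * cluster_freq j + (1 - p) * (j == 0)%:R) / (1 + p * j.+1%:R)
  else 0.

Lemma cluster_freq_den k : 0 < 1 + p * k.+1%:R.
Proof. by rewrite addr_gt0 // mulr_gt0. Qed.

Lemma cluster_freqS k : (1 + p * k.+1%:R) * cluster_freq k.+1 =
  p * k%:R * cluster_freq k + (1 - p) * (k == 0)%:R.
Proof. by rewrite mulrC divfK // gt_eqF // cluster_freq_den. Qed.

Lemma cluster_freq_bound k : 0 <= cluster_freq k <= 1.
Proof.
elim: k => [|k /andP[a0 a1]]; first by rewrite /= lexx ler01.
have k0 : 0 <= k%:R :> R by [].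
rewrite /= ler_pdivlMr ?cluster_freq_den // mul0r ler_pdivrMr ?cluster_freq_den //.
have : 0 <= p * k%:R * cluster_freq k <= p * k%:R.
  have pk : 0 <= p * k%:R by rewrite mulr_ge0 // ltW.
  by rewrite mulr_ge0 //= ler_piMr.
rewrite -natr1 mul1r (mulrDr p) mulr1.
case/andP; move: (p * k%:R * _) => u; move: (p * k%:R) => v u0 uv.
have := p_gt0; have := p_lt1.
by case: (k == 0)%N => /=; rewrite ?mulr1 ?mulr0 => ? ?; apply/andP; split; lra.
Qed.

Definition clusters (k : nat) (r : seq nat) : R :=
  cluster_sum (fun j => (j == k)%:R) r.

Lemma clusters_bound k r : 0 <= clusters k r <= (size r)%:R.
Proof.
rewrite cluster_sum_ge0 //= -cluster_sum_size; apply: ler_cluster_sum => j.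
by case: eqP => // _ /andP[j0 _]; rewrite ler1n.
Qed.

Definition clusters_dev (k : nat) (r : seq nat) : R :=
  clusters k r - cluster_freq k * (size r)%:R.

Lemma clusters_dev_le k r : `|clusters_dev k r| <= (size r)%:R.
Proof.
have /andP[c0 c1] := clusters_bound k r; have /andP[a0 a1] := cluster_freq_bound k.
have : 0 <= cluster_freq k * (size r)%:R <= (size r)%:R by rewrite mulr_ge0 //= ler_piMl.
rewrite /clusters_dev ler_norml; move=> /andP[? ?]; apply/andP; split; lra.
Qed.

Lemma clusters_dev_new k r y : y \notin r ->
  clusters_dev k (y :: r) - clusters_dev k r = (1 == k)%:R - cluster_freq k.
Proof.
by move=> yr; rewrite /clusters_dev /clusters cluster_sum_new //= -natr1; ring.
Qed.

Lemma clusters_dev_copy k r y : y \in r ->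
  clusters_dev k (y :: r) - clusters_dev k r =
  (cluster_sum (fun j => (j == k)%:R) (y :: r)
   - cluster_sum (fun j => (j == k)%:R) r) - cluster_freq k.
Proof. by move=> yr; rewrite /clusters_dev /clusters /= -natr1; ring. Qed.

Lemma clusters_dev_incr k r y : `|clusters_dev k (y :: r) - clusters_dev k r| <= 2.
Proof.
have /andP[a0 a1] := cluster_freq_bound k.
case: (boolP (y \in r)) => yr; last first.
  by rewrite clusters_dev_new // ler_norml; case: eqP => _ /=; apply/andP; split; lra.
rewrite clusters_dev_copy // cluster_sum_copy // ler_norml.
by case: eqP => _; case: eqP => _ /=; apply/andP; split; lra.
Qed.

(** A copy made in a cluster of size k moves it from count k to count k + 1. *)
Lemma clusters_drift k r :
  \sum_(x <- r) (clusters_dev k.+1 (x :: r) - clusters_dev k.+1 r) =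
  k%:R * clusters k r - k.+1%:R * clusters k.+1 r
  - cluster_freq k.+1 * (size r)%:R.
Proof.
under eq_big_seq do rewrite clusters_dev_copy //.
rewrite big_split /= cluster_sum_drift big_const_seq count_predT iter_addr_0.
rewrite -[(- cluster_freq k.+1) *+ _]mulr_natr mulNr; congr (_ - _).
rewrite -mulNr -!cluster_sumZ -cluster_sumD; apply: eq_cluster_sum => j _.
rewrite eqSS; case: (eqVneq j k) => [->|jk].
  by rewrite (ltn_eqF (ltnSn k)) /=; ring.
by case: (eqVneq j k.+1) => [->|_] /=; ring.
Qed.

(** The drift of the deviation D_k+1 is a pull towards 0, which is dropped, plus
    p k D_k / n.  In the drift of the square the latter is multiplied by 2 D_k+1,
    and |D_k+1| <= n cancels the 1 / n.  The constant 4 bounds the square of an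
    increment. *)
Lemma clusters_dev_var n k :
  swim_mean p n.+1 (fun r => clusters_dev k.+1 r ^+ 2) <=
  swim_mean p n (fun r => clusters_dev k.+1 r ^+ 2)
  + 2 * k%:R * swim_mean p n (fun r => `|clusters_dev k r|) + 4.
Proof.
rewrite swim_meanS // -addrA lerD2l -swim_meanZ // -(swim_mean_cst p01 n 4) -swim_meanD //.
apply: ler_swim_mean => // r lr; have /andP[/eqP sr _] := lr.
set D := clusters_dev k.+1 r.
have sq y : clusters_dev k.+1 (y :: r) ^+ 2 - D ^+ 2 <=
    2 * D * (clusters_dev k.+1 (y :: r) - D) + 4.
  have := clusters_dev_incr k.+1 r y; rewrite -/D ler_norml => /andP[? ?].
  have : 0 <= (2 - (clusters_dev k.+1 (y :: r) - D)) *
              (2 + (clusters_dev k.+1 (y :: r) - D)) by apply: mulr_ge0; lra.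
  lra.
have N0 : 0 < n.+1%:R :> R by [].
have H1 : (1 - p) * (clusters_dev k.+1 (n.+2 :: r) ^+ 2 - D ^+ 2) <=
    (1 - p) * (2 * D * ((k == 0)%:R - cluster_freq k.+1) + 4).
  have := sq n.+2; rewrite clusters_dev_new ?(labelling_fresh lr) //.
  by rewrite eqSS eq_sym => h; rewrite ler_wpM2l // subr_ge0 ltW.
have H2 : p / n.+1%:R * \sum_(x <- r) (clusters_dev k.+1 (x :: r) ^+ 2 - D ^+ 2) <=
   p / n.+1%:R * (2 * D * (k%:R * clusters k r - k.+1%:R * clusters k.+1 r
     - cluster_freq k.+1 * n.+1%:R) + 4 * n.+1%:R).
  rewrite ler_wpM2l ?divr_ge0 // ?(ltW p_gt0) // -[in leRHS]sr -clusters_drift.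
  rewrite big_distrr /=.
  rewrite (_ : 4 * _ = \sum_(x <- r) 4); last first.
    by rewrite big_const_seq count_predT iter_addr_0 mulr_natr.
  by rewrite -big_split; apply: ler_sum => x _; apply: sq.
apply: le_trans (lerD H1 H2) _.
have E : (1 - p) * (2 * D * ((k == 0)%:R - cluster_freq k.+1) + 4) +
   p / n.+1%:R * (2 * D * (k%:R * clusters k r - k.+1%:R * clusters k.+1 r
     - cluster_freq k.+1 * n.+1%:R) + 4 * n.+1%:R) =
   2 * k%:R * (p * (D * clusters_dev k r / n.+1%:R)) + 4
   - 2 * p * k.+1%:R / n.+1%:R * D ^+ 2
   + 2 * D * (p * k%:R * cluster_freq k + (1 - p) * (k == 0)%:R
       - (1 + p * k.+1%:R) * cluster_freq k.+1).
  rewrite /D /clusters_dev sr; have := lt0r_neq0 N0.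
  move: n.+1%:R (k == 0)%:R (cluster_freq k.+1) => N b a N0'.
  by rewrite -(natr1 k); field.
rewrite E -cluster_freqS subrr mulr0 addr0 lerBlDr ler_wpDr //.
  rewrite mulr_ge0 ?sqr_ge0 // !mulr_ge0 //; exact: ltW.
rewrite lerD2r ler_wpM2l ?mulr_ge0 //.
have Dk : `|D * clusters_dev k r / n.+1%:R| <= `|clusters_dev k r|.
  rewrite !normrM normfV (gtr0_norm N0) ler_pdivrMr // mulrC.
  by rewrite ler_wpM2l // -sr clusters_dev_le.
have : p * (D * clusters_dev k r / n.+1%:R) <= 1 * `|D * clusters_dev k r / n.+1%:R|.
  apply: le_trans (ler_norm _) _; rewrite normrM (gtr0_norm p_gt0).
  by rewrite ler_wpM2r // ltW.
rewrite mul1r => h; exact: le_trans h Dk.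
Qed.

(** Summing the recursion [clusters_dev_var] turns an o(n) bound in mean at size k
    into an o(n^2) bound in mean square at size k + 1.  The o(n) is expressed with
    an additive constant, so that it holds for all n and is stable by sums. *)
Lemma clusters_lln k (e : R) : 0 < e -> exists2 C : R, 0 <= C & forall n,
  swim_mean p n (fun r => `|clusters_dev k r|) <= e * n.+1%:R + C.
Proof.
elim: k e => [|k IH] e e0.
  exists 0 => // n; rewrite addr0 -[leRHS](swim_mean_cst p01 n).
  apply: ler_swim_mean => // r _; rewrite /clusters_dev mul0r subr0 /clusters.
  rewrite (_ : cluster_sum _ _ = cluster_sum (fun=> 0) r); last first.
    by apply: eq_cluster_sum => j; case: j.
  by rewrite /cluster_sum big1 // normr0 mulr_ge0 // ltW.
have e20 : 0 < e ^+ 2 by rewrite exprn_gt0.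
have kk : 0 < 2 * (k%:R + 1) :> R by rewrite mulr_gt0 // ltr_wpDl.
have [C1 C10 hC1] := IH (e ^+ 2 / (2 * (k%:R + 1))) (divr_gt0 e20 kk).
pose C := 5 + 2 * k%:R * C1.
have C0 : 0 <= C by rewrite addr_ge0 // !mulr_ge0.
have var n : swim_mean p n (fun r => clusters_dev k.+1 r ^+ 2) <=
    n.+1%:R * (e ^+ 2 * n.+1%:R + C).
  elim: n => [|n IHn].
    rewrite /= mul1r mulr1.
    have := clusters_dev_le k.+1 [:: 1%N]; rewrite /= => h.
    have : `|clusters_dev k.+1 [:: 1%N]| ^+ 2 <= 1 by rewrite expr_le1.
    rewrite real_normK ?num_real // => h2.
    have h3 : 0 <= 2 * k%:R * C1 by rewrite !mulr_ge0.
    rewrite /C; lra.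
  apply: le_trans (clusters_dev_var n k) _.
  have h1 : 2 * k%:R * swim_mean p n (fun r => `|clusters_dev k r|) <=
      e ^+ 2 * n.+1%:R + 2 * k%:R * C1.
    apply: le_trans (ler_wpM2l _ (hC1 n)) _; first by rewrite mulr_ge0.
    rewrite mulrDr lerD2r mulrA ler_wpM2r // mulrCA ler_piMr ?(ltW e20) //.
    by rewrite ler_pdivrMr //; have := ler0n R k; lra.
  have N0 : 0 < n.+1%:R :> R by [].
  have eN : 0 <= e ^+ 2 * n.+1%:R by rewrite mulr_ge0 // ltW.
  rewrite -[n.+2%:R]natr1 /C in IHn *; move: n.+1%:R N0 IHn h1 eN => N N0 IHn h1 eN.
  by move: IHn h1 eN e20; lra.
exists (C / (2 * e)) => [|n]; first by rewrite divr_ge0 // mulr_ge0 // ltW.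
have N0 : 0 < n.+1%:R :> R by [].
apply: (@le_trans _ _ (swim_mean p n (fun r =>
    e * n.+1%:R / 2 + (2 * e * n.+1%:R)^-1 * clusters_dev k.+1 r ^+ 2))).
  apply: ler_swim_mean => // r _.
  have d0 : 0 < 2 * e * n.+1%:R by rewrite !mulr_gt0.
  (* AM-GM: e N / 2 + D^2 / (2 e N) - |D| = (e N - |D|)^2 / (2 e N) *)
  rewrite -subr_ge0 -(pmulr_rge0 _ d0).
  have -> : 2 * e * n.+1%:R * (e * n.+1%:R / 2 + (2 * e * n.+1%:R)^-1 *
     clusters_dev k.+1 r ^+ 2 - `|clusters_dev k.+1 r|) =
     (e * n.+1%:R - `|clusters_dev k.+1 r|) ^+ 2.
    rewrite -[clusters_dev k.+1 r ^+ 2]real_normK ?num_real //.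
    by move: n.+1%:R N0 d0 => N /lt0r_neq0 N0 _; move/lt0r_neq0 : e0 => e0; field; rewrite ?N0 ?e0.
  exact: sqr_ge0.
rewrite swim_meanD // swim_mean_cst // swim_meanZ //.
apply: le_trans (_ : e * n.+1%:R / 2 +
  (2 * e * n.+1%:R)^-1 * (n.+1%:R * (e ^+ 2 * n.+1%:R + C)) <= _).
  by rewrite lerD2l ler_wpM2l ?var // invr_ge0 !mulr_ge0 // ltW.
by rewrite le_eqVlt; apply/orP; left; apply/eqP; field; rewrite lt0r_neq0 //= lt0r_neq0.
Qed.

End ClusterCount.

(** * Moments of the cluster sizes and law of large numbers *)

Section Moments.
Variables (R : realType) (p : R).
Hypothesis p01 : 0 < p < 1.

Let p_gt0 : 0 < p. Proof. by case/andP: p01. Qed.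
Let p_lt1 : p < 1. Proof. by case/andP: p01. Qed.

(** (1 + 1/k)^b <= exp(b / k), and exp(- b / k) >= 1 - b / k. *)
Lemma powR_succ_le (b : R) k : 0 < b -> b < k%:R ->
  k.+1%:R `^ b <= k%:R `^ b / (1 - b / k%:R).
Proof.
move=> b0 bk; have k0 : 0 < k%:R :> R := lt_trans b0 bk.
have d0 : 0 < 1 - b / k%:R by rewrite subr_gt0 ltr_pdivrMr // mul1r.
have -> : k.+1%:R = k%:R * (1 + k%:R^-1) :> R.
  by rewrite mulrDr mulr1 divff ?lt0r_neq0 // natr1.
have k1 : 0 < 1 + k%:R^-1 :> R by rewrite addr_gt0 // invr_gt0.
rewrite powRM ?(ltW k1) // ler_wpM2l ?powR_ge0 // /powR (gt_eqF k1).
rewrite -[leRHS]invrK ; first rewrite invrK -[leLHS]invrK lef_pV2 ?posrE ?invr_gt0 ?expR_gt0 //.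
rewrite -expRN; apply: le_trans (expR_ge1Dx _); rewrite lerD2l lerN2.
rewrite ler_pM2l //; apply: le_ln1Dx.
by rewrite (lt_trans _ (_ : 0 < k%:R^-1)) ?invr_gt0 // oppr_lt0.
Qed.

(** The drift of k^b is asymptotic to p b k^b, so any rate g > p b dominates it
    up to a constant, which pays for the finitely many small k. *)
Lemma powR_drift_le (b g : R) : 0 < b -> p * b < g ->
  exists2 C : R, 0 <= C & forall k, (0 < k)%N ->
    p * (k%:R * (k.+1%:R `^ b - k%:R `^ b)) <= g * k%:R `^ b + C.
Proof.
move=> b0 pbg.
have g0 : 0 < g by apply: lt_trans pbg; rewrite mulr_gt0.
have gpb : 0 < g - p * b by rewrite subr_gt0.
have x0 : 0 <= b + g * b / (g - p * b).
  by rewrite addr_ge0 ?(ltW b0) // divr_ge0 ?(ltW gpb) // mulr_ge0 // ltW.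
pose K := Num.bound (b + g * b / (g - p * b)).
have hK : b + g * b / (g - p * b) < K%:R by exact: archi_boundP.
exists (K%:R * K.+1%:R `^ b) => [|k k0]; first by rewrite mulr_ge0 ?powR_ge0.
have P0 : 0 <= k%:R `^ b by exact: powR_ge0.
have P1 : 0 <= k.+1%:R `^ b by exact: powR_ge0.
case: (leqP K k) => kK; last first.
  rewrite (@le_trans _ _ (K%:R * K.+1%:R `^ b)) //; last first.
    by rewrite lerDr mulr_ge0 // ltW.
  apply: (@le_trans _ _ (k%:R * (k.+1%:R `^ b - k%:R `^ b))).
    rewrite ler_piMl ?(ltW p_lt1) // mulr_ge0 // subr_ge0.
    by rewrite ge0_ler_powR ?(ltW b0) ?nnegrE // ler_nat.
  apply: ler_pM => //.
  - by rewrite subr_ge0 ge0_ler_powR ?(ltW b0) ?nnegrE // ler_nat.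
  - by rewrite ler_nat ltnW.
  - rewrite (@le_trans _ _ (k.+1%:R `^ b)) // ?gerBl //.
    by rewrite ge0_ler_powR ?(ltW b0) ?nnegrE // ler_nat ltnW.
have hk : b + g * b / (g - p * b) < k%:R by apply: lt_le_trans hK _; rewrite ler_nat.
have hb : b < k%:R by apply: le_lt_trans hk; rewrite lerDl divr_ge0 ?(ltW gpb) // mulr_ge0 // ltW.
have kR : 0 < k%:R :> R := lt_trans b0 hb.
rewrite ler_wpDr ?mulr_ge0 ?powR_ge0 //.
have d0 : 0 < 1 - b / k%:R by rewrite subr_gt0 ltr_pdivrMr // mul1r.
apply: (@le_trans _ _ (k%:R `^ b * (p * b / (1 - b / k%:R)))).
  have -> : k%:R `^ b * (p * b / (1 - b / k%:R)) =
      p * (k%:R * (k%:R `^ b / (1 - b / k%:R) - k%:R `^ b)).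
    move: (k%:R `^ b) d0 => A /lt0r_neq0; move/lt0r_neq0: kR; move: k%:R => k' k'0 d0.
    by field; rewrite k'0 /=; apply: contra d0 => /eqP h; rewrite -(divff k'0) -mulrBl h mul0r.
  by rewrite ler_pM2l // ler_pM2l // lerD2r powR_succ_le.
rewrite mulrC ler_wpM2r // ler_pdivrMr // mulrBr mulr1 lerBrDr -lerBrDl mulrA.
rewrite ler_pdivrMr // -ler_pdivrMl // mulrC; apply: ltW; apply: le_lt_trans hk.
by rewrite lerDr ltW.
Qed.

(** With M_n the mean of the sum of (size)^b, the drift bound gives
    M_(n+1) <= M_n (1 + g / n) + const with g < 1, which linear growth satisfies. *)
Lemma swim_moment_le (b : R) : 0 < b -> p * b < 1 ->
  exists2 C : R, 0 <= C & forall n,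
    swim_mean p n (cluster_sum (fun k => k%:R `^ b)) <= C * n.+1%:R.
Proof.
move=> b0 pb.
have [g g1 pbg] : exists2 g, g < 1 & p * b < g by exists ((1 + p * b) / 2); lra.
have [C' C'0 hC'] := powR_drift_le b0 pbg.
pose C := (1 + C') / (1 - g).
have g10 : 0 < 1 - g by rewrite subr_gt0.
have EC : C * (1 - g) = 1 + C' by rewrite divfK // lt0r_neq0.
have g0 : 0 <= g by apply: ltW; apply: lt_trans pbg; rewrite mulr_gt0.
have C0 : 0 <= C by rewrite divr_ge0 ?(ltW g10) ?addr_ge0.
have C1 : 1 <= C by rewrite ler_pdivlMr // mul1r; lra.
move: C C0 C1 EC => C C0 C1 EC.
exists C => //; elim=> [|n IH].
  by rewrite /= /cluster_sum /= big_seq1 eqxx powR1 mulr1.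
rewrite swim_meanS //.
have H : swim_mean p n (fun r =>
    (1 - p) * (cluster_sum (fun k => k%:R `^ b) (n.+2 :: r) - cluster_sum (fun k => k%:R `^ b) r) +
    p / n.+1%:R * \sum_(x <- r) (cluster_sum (fun k => k%:R `^ b) (x :: r)
                                 - cluster_sum (fun k => k%:R `^ b) r))
   <= 1 + C' + g / n.+1%:R * swim_mean p n (cluster_sum (fun k => k%:R `^ b)).
  rewrite -swim_meanZ // -(swim_mean_cst p01 n (1 + C')) -swim_meanD //.
  apply: ler_swim_mean => // r lr; have /andP[/eqP sr _] := lr.
  rewrite cluster_sum_new ?(labelling_fresh lr) // powR1 addrK mulr1 -[leRHS]addrA.
  apply: lerD; first by rewrite gerBl ltW.
  rewrite cluster_sum_drift [p / _]mulrC [g / _]mulrC -!mulrA.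
  have -> : C' = n.+1%:R^-1 * (C' * n.+1%:R) by rewrite mulrCA mulVf ?mulr1.
  rewrite -mulrDr ler_pM2l ?invr_gt0 // -[in leRHS]sr -cluster_sum_size.
  rewrite -!cluster_sumZ -cluster_sumD; apply: ler_cluster_sum => k /andP[k0 _].
  apply: le_trans (hC' k k0) _; rewrite addrC lerD2r.
  by rewrite ler_peMr // ler1n.
have N0 : 0 < n.+1%:R :> R by [].
have H2 : g / n.+1%:R * swim_mean p n (cluster_sum (fun k => k%:R `^ b)) <= g * C.
  rewrite -mulrA ler_wpM2l // mulrC ler_pdivrMr //.
have -> : n.+2%:R = n.+1%:R + 1 :> R by rewrite natr1.
rewrite mulrDr mulr1; apply: lerD => //; apply: le_trans H _.
move: H2 EC; move: (g / _ * _) => u; lra.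
Qed.

Definition truncated_sum (f : nat -> R) (K : nat) (r : seq nat) : R :=
  \sum_(k < K) f k * clusters R k r.

(** Counting clusters by size is truncating the sum over the clusters. *)
Lemma truncated_sumE f K r :
  truncated_sum f K r = cluster_sum (fun j => f j * (j < K)%:R) r.
Proof.
elim: K => [|K IH].
  rewrite /truncated_sum big_ord0 /cluster_sum big1 // => j _.
  by rewrite ltn0 mulr0.
rewrite /truncated_sum big_ord_recr /= -/(truncated_sum f K r) IH.
rewrite -cluster_sumZ -cluster_sumD; apply: eq_cluster_sum => j _.
rewrite [in RHS]ltnS [in RHS]leq_eqVlt; case: eqVneq => [->|_] /=.
  by rewrite ltnn mulr0 add0r.
by rewrite mulr0 addr0.
Qed.

Definition freq_sum (f : nat -> R) (K : nat) : R :=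
  \sum_(k < K) f k * cluster_freq p k.

Lemma truncated_lln f K (e : R) : 0 < e -> exists2 C : R, 0 <= C & forall n,
  swim_mean p n (fun r => `|truncated_sum f K r - freq_sum f K * (size r)%:R|)
  <= e * n.+1%:R + C.
Proof.
elim: K e => [|K IH] e e0.
  exists 0 => // n; rewrite addr0 -[leRHS](swim_mean_cst p01 n).
  apply: ler_swim_mean => // r _.
  by rewrite /truncated_sum /freq_sum !big_ord0 mul0r subr0 normr0 mulr_ge0 // ltW.
have e20 : 0 < e / 2 by rewrite divr_gt0.
have f0 : 0 < `|f K| + 1 by rewrite ltr_wpDl.
have [C1 C10 h1] := IH _ e20.
have [C2 C20 h2] := clusters_lln p01 K (divr_gt0 e20 f0).
exists (C1 + `|f K| * C2) => [|n]; first by rewrite addr_ge0 // mulr_ge0.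
apply: (@le_trans _ _ (swim_mean p n (fun r =>
   `|truncated_sum f K r - freq_sum f K * (size r)%:R| + `|f K| * `|clusters_dev p K r|))).
  apply: ler_swim_mean => // r _; rewrite -normrM; apply: le_trans (ler_normD _ _).
  rewrite /truncated_sum /freq_sum !big_ord_recr /= /clusters_dev.
  by rewrite le_eqVlt; apply/orP; left; apply/eqP; congr (`| _ |); ring.
rewrite swim_meanD // swim_meanZ //.
have h3 := ler_wpM2l (normr_ge0 (f K)) (h2 n).
have h4 : `|f K| * (e / 2 / (`|f K| + 1) * n.+1%:R) <= e / 2 * n.+1%:R.
  rewrite mulrA ler_wpM2r // mulrCA ler_piMr ?(ltW e20) //.
  by rewrite ler_pdivrMr // mul1r lerDl.
move: h3 (h1 n) h4; rewrite mulrDr; lra.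
Qed.

(** The partial sums are limits of averages dominated by the a-th moment, hence
    bounded by the constant of [swim_moment_le] (up to 1, for the error). *)
Lemma freq_sum_le (a : R) : 0 < a -> p * a < 1 ->
  exists C : R, forall K, freq_sum (fun k => k%:R `^ a) K <= C.
Proof.
move=> a0 pa; have [C C0 hC] := swim_moment_le a0 pa; exists (C + 1) => K.
have [C' C'0 hC'] := truncated_lln (fun k => k%:R `^ a) K ltr01.
have H n : freq_sum (fun k => k%:R `^ a) K * n.+1%:R <= (C + 1) * n.+1%:R + C'.
  rewrite -(swim_mean_cst p01 n (freq_sum _ _ * _)).
  apply: (@le_trans _ _ (swim_mean p n (fun r => cluster_sum (fun k => k%:R `^ a) r +
      `|truncated_sum (fun k => k%:R `^ a) K r
        - freq_sum (fun k => k%:R `^ a) K * (size r)%:R|))).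
    apply: ler_swim_mean => // r /andP[/eqP sr _]; rewrite -sr.
    have : truncated_sum (fun k => k%:R `^ a) K r <= cluster_sum (fun k => k%:R `^ a) r.
      rewrite truncated_sumE; apply: ler_cluster_sum => k _.
      by rewrite ler_piMr ?powR_ge0 // lern1 leq_b1.
    have := ler_norm (- (truncated_sum (fun k => k%:R `^ a) K r
      - freq_sum (fun k => k%:R `^ a) K * (size r)%:R)); rewrite normrN.
    lra.
  by rewrite swim_meanD //; move: (hC n) (hC' n); lra.
rewrite leNgt; apply/negP; rewrite -subr_gt0 => d0.
set d := _ - _ in d0; pose n := Num.bound (C' / d).
have := H n; rewrite -lerBlDl -mulrBl -/d -ler_pdivlMl // mulrC leNgt => /negP; apply.
have := archi_boundP (divr_ge0 C'0 (ltW d0)); rewrite -/n => /lt_trans; apply.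
by rewrite ltr_nat.
Qed.

Lemma freq_sum_nondecreasing (a : R) :
  nondecreasing_seq (freq_sum (fun k => k%:R `^ a)).
Proof.
apply/nondecreasing_seqP => K; rewrite /freq_sum big_ord_recr /= lerDl.
by rewrite mulr_ge0 ?powR_ge0 //; case/andP: (cluster_freq_bound p01 K).
Qed.

Lemma freq_sum_cvg (a : R) : 0 < a -> p * a < 1 ->
  cvgn (freq_sum (fun k => k%:R `^ a)).
Proof.
move=> a0 pa; have [C hC] := freq_sum_le a0 pa.
apply: nondecreasing_is_cvgn; first exact: freq_sum_nondecreasing.
by exists C => _ [K _ <-].
Qed.

(** Sizes below K are handled by [truncated_lln]; a cluster of size k >= K
    contributes k^a <= K^(a - b) k^b, whose mean is at most K^(a - b) M n. *)
Lemma swim_lln (a e : R) : 0 < a -> p * a < 1 -> 0 < e ->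
  exists2 C : R, 0 <= C & forall n,
  swim_mean p n (fun r => `|cluster_sum (fun k => k%:R `^ a) r
     - limn (freq_sum (fun k => k%:R `^ a)) * (size r)%:R|) <= e * n.+1%:R + C.
Proof.
move=> a0 pa e0; set c := limn _.
(* any exponent b with a < b < 1 / p controls the tail of the k^a *)
pose b := (a + p^-1) / 2.
have ab : a < b.
  have : a < p^-1 by rewrite -div1r ltr_pdivlMr // mulrC.
  by rewrite /b; lra.
have pb : p * b < 1 by rewrite /b mulrA mulrDr divff ?lt0r_neq0 //; lra.
have b0 : 0 < b := lt_trans a0 ab.
have [M M0 hM] := swim_moment_le b0 pb.
have cc := freq_sum_cvg a0 pa.
have e30 : 0 < e / 3 by rewrite divr_gt0.
have : \forall K \near \oo, `|c - freq_sum (fun k => k%:R `^ a) K| < e / 3.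
  by move/cvgrPdist_lt : cc; apply.
move=> [K0 _ hK0].
have M10 : 0 < M + 1 by rewrite ltr_wpDl.
(* chosen so that x^(a - b) M <= e / 3 *)
pose x := (3 * (M + 1) / e) `^ (b - a)^-1.
have x0 : 0 <= x by exact: powR_ge0.
pose K := maxn (maxn K0 1) (Num.bound x).
have K1 : (0 < K)%N by rewrite !leq_max leqnn orbT.
have /hK0 hc : (K0 <= K)%N by rewrite !leq_max leqnn.
have KR : 0 < K%:R :> R by rewrite ltr0n.
have ba0 : 0 < b - a by rewrite subr_gt0.
have tail : K%:R `^ (a - b) * M <= e / 3.
  have xK : x <= K%:R.
    apply: ltW; apply: (lt_le_trans (archi_boundP x0)).
    by rewrite ler_nat /K leq_maxr.
  have : 3 * (M + 1) / e <= K%:R `^ (b - a).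
    have -> : 3 * (M + 1) / e = x `^ (b - a).
      by rewrite /x -powRrM mulVf ?lt0r_neq0 // powRr1 // divr_ge0 ?mulr_ge0 // ltW.
    by rewrite ge0_ler_powR // ?(ltW ba0) // nnegrE ltW.
  move=> h; rewrite -opprB powRN.
  have h0 : 0 < 3 * (M + 1) / e by rewrite divr_gt0 // mulr_gt0.
  rewrite mulrC ler_pdivrMr; last exact: lt_le_trans h0 h.
  apply: (@le_trans _ _ (e / 3 * (3 * (M + 1) / e))); last by rewrite ler_pM2l.
  rewrite (_ : e / 3 * _ = M + 1) ?lerDl //; field; exact: lt0r_neq0.
have [C C0 hC] := truncated_lln (fun k => k%:R `^ a) K e30.
exists C => // n.
apply: (@le_trans _ _ (swim_mean p n (fun r =>
   (`|truncated_sum (fun k => k%:R `^ a) K r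
        - freq_sum (fun k => k%:R `^ a) K * (size r)%:R| +
   K%:R `^ (a - b) * cluster_sum (fun k => k%:R `^ b) r) + e / 3 * n.+1%:R))).
  apply: ler_swim_mean => // r /andP[/eqP sr _]; rewrite -sr.
  set A := cluster_sum _ r; set B := truncated_sum _ _ _; set s := freq_sum _ _.
  have AB : `|A - B| <= K%:R `^ (a - b) * cluster_sum (fun k => k%:R `^ b) r.
    have -> : A - B = cluster_sum (fun k => k%:R `^ a * (K <= k)%:R) r.
      rewrite /A /B truncated_sumE -[X in _ - X]mul1r -mulNr -cluster_sumZ -cluster_sumD.
      apply: eq_cluster_sum => k _; rewrite ltnNge; case: (K <= k)%N => /=; ring.
    rewrite ger0_norm; last by apply: cluster_sum_ge0 => k _; rewrite mulr_ge0 ?powR_ge0.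
    rewrite -cluster_sumZ; apply: ler_cluster_sum => k /andP[k0 _].
    case: leqP => Kk; last by rewrite mulr0 mulr_ge0 ?powR_ge0.
    have kR : 0 < k%:R :> R by rewrite ltr0n.
    rewrite mulr1 -[a in leLHS](subrK b) [in leLHS]powRD; last first.
      by rewrite (gt_eqF kR) implybT.
    rewrite ler_wpM2r ?powR_ge0 // -opprB !powRN lef_pV2 ?posrE ?powR_gt0 //.
    by rewrite ge0_ler_powR ?(ltW ba0) // ?nnegrE ?ler_nat.
  have SC : `|s * (size r)%:R - c * (size r)%:R| <= e / 3 * (size r)%:R.
    rewrite -mulrBl normrM [X in _ * X]ger0_norm // ler_wpM2r // distrC; exact: ltW.
  rewrite (_ : A - _ = (B - s * (size r)%:R) + (A - B) + (s * (size r)%:R - c * (size r)%:R)); last by ring.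
  by do 2!(apply: le_trans (ler_normD _ _) _; apply: lerD => //).
rewrite !swim_meanD // swim_meanZ // swim_mean_cst //.
have := ler_wpM2l (powR_ge0 K%:R (a - b)) (hM n).
have N0 : 0 <= n.+1%:R :> R by [].
have := ler_wpM2r N0 tail.
have := hC n; lra.
Qed.

End Moments.

(** * The constant as a sum over cluster sizes *)

Section SwimConstant.
Variables (R : realType) (p : R).
Hypothesis p01 : 0 < p < 1.

Let p_gt0 : 0 < p. Proof. by case/andP: p01. Qed.
Let p_lt1 : p < 1. Proof. by case/andP: p01. Qed.
Let L : R := 1 - p.
Let L_gt0 : 0 < L. Proof. by rewrite subr_gt0. Qed.
Let mu := @lebesgue_measure R.

Definition geom_param (x : R) : R := (x / (1 - p)) `^ p.
Local Notation q := geom_param.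


Lemma geom_param0 : q 0 = 0.
Proof. by rewrite /q mul0r powR0 // lt0r_neq0. Qed.

Lemma geom_param1 : q L = 1.
Proof. by rewrite /q divff ?lt0r_neq0 // powR1. Qed.

Lemma geom_param_bound x : 0 <= x <= L -> 0 <= q x <= 1.
Proof.
move=> /andP[x0 xL]; rewrite powR_ge0 /= -geom_param1.
rewrite /q ge0_ler_powR ?(ltW p_gt0) // ?nnegrE ?divr_ge0 ?(ltW L_gt0) //.
by rewrite ler_pM2r // invr_gt0.
Qed.

Lemma is_derive_geom_param (x : R) : 0 < x -> is_derive x 1 q (p * q x / x).
Proof.
move=> x0; have xL : 0 < x / L by rewrite divr_gt0.
have h1 : is_derive x (1 : R) (L^-1 \*: (id : R -> R)) (L^-1 *: 1) by exact: is_deriveZ.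
have h2 : is_derive ((L^-1 \*: (id : R -> R)) x) 1 (@powR R ^~ p) (p * (x / L) `^ (p - 1)).
  rewrite /= /GRing.scale /= mulrC; exact: is_derive1_powR.
have := is_derive1_comp h2 h1.
have -> : (@powR R ^~ p) \o (L^-1 \*: (id : R -> R)) = q.
  by apply/funext => y; rewrite /q /= /GRing.scale /= mulrC.
move=> h; apply: is_derive_eq.
rewrite /q -/L -(mulr_powRB1 (ltW xL) p_gt0) /GRing.scale /= mulr1.
by field; rewrite !lt0r_neq0.
Qed.

Definition geom_weight (k : nat) (x : R) : R := (1 - q x) ^+ k * q x.

(** Since x q'(x) = p q(x), the derivative of x (1 - q)^k q is again a combination
    of the geometric weights, with the coefficients of [cluster_freqS]. *)
Let antider (k : nat) (x : R) : R := x * geom_weight k x.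

Let is_derive_antider k (x : R) : 0 < x -> is_derive x 1 (antider k)
  ((1 + p * k.+1%:R) * geom_weight k x - p * k%:R * geom_weight k.-1 x).
Proof.
move=> x0; have H := is_derive_geom_param x0.
have -> : antider k = (id : R -> R) * ((cst 1 - q) ^+ k * q).
  by apply/funext => y; rewrite /antider /geom_weight !fctE.
have H1 : is_derive x 1 (cst 1 - q) (0 - p * q x / x) by exact: is_deriveB.
apply: is_derive_eq; rewrite /geom_weight /GRing.scale /= !fctE.
have x00 := lt0r_neq0 x0.
case: k => [|k] /=; first by rewrite expr0 mulr0n /= ; field.
by rewrite [(1 - q x) ^+ k.+1]exprS -[k.+2%:R]natr1 -mulr_natr; field.
Qed.

(** Continuity at 0 is only from the right: a negative number has power 1. *)
Lemma geom_param_continuous : {within `[0, L], continuous q}.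
Proof.
apply: derivable_oo_LRcontinuous_within; split.
- move=> x; rewrite in_itv /= => /andP[x0 _].
  by have [] := is_derive_geom_param x0.
- rewrite geom_param0 /q.
  apply: (@cvg_trans _ ((x `^ p * L^-1 `^ p) @[x --> 0^'+])).
    apply: near_eq_cvg; near=> y.
    have y0 : 0 <= y by near: y; exact: nbhs_right_ge.
    by rewrite powRM // invr_ge0 ltW.
  have : x `^ p * L^-1 `^ p @[x --> 0^'+] --> 0 * (L^-1 `^ p).
    by apply: cvgM; [exact: powR_cvg0|exact: cvg_cst].
  by rewrite mul0r.
- have [+ _] := is_derive_geom_param L_gt0.
  by move/derivable1_diffP/differentiable_continuous; exact: cvg_at_left_filter.
Unshelve. all: by end_near. Qed.

Lemma geom_weight_continuous {k} : {within `[0, L], continuous (geom_weight k)}.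
Proof.
apply/subspace_continuousP => x xL.
have qx : q @ within `[0, L] (nbhs x) --> q x.
  by move/subspace_continuousP : geom_param_continuous; exact.
apply: cvgM => //.
elim: k => [|k IH]; first by under eq_fun do rewrite expr0; rewrite expr0; exact: cvg_cst.
rewrite exprS; under eq_fun do rewrite exprS.
by apply: cvgM => //; apply: cvgB => //; exact: cvg_cst.
Qed.

Lemma geom_weight_integrable k : mu.-integrable `[0, L] (EFin \o geom_weight k).
Proof.
apply: continuous_compact_integrable; first exact: segment_compact.
exact: geom_weight_continuous.
Qed.

Lemma geom_weight_ge0 k x : 0 <= x <= L -> 0 <= geom_weight k x.
Proof.
by move=> /geom_param_bound/andP[q0 q1]; rewrite mulr_ge0 // exprn_ge0 // subr_ge0.
Qed.

(** Integrating [is_derive_antider] yields the recursion of the frequencies; the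
    boundary term at 1 - p is where (1 - q)^k vanishes unless k = 0. *)
Lemma Rintegral_geom_weight k :
  \int[mu]_(x in `[0, L]) geom_weight k x = cluster_freq p k.+1.
Proof.
pose I k := \int[mu]_(x in `[0, L]) geom_weight k x; rewrite -/(I k).
have rec k' : (1 + p * k'.+1%:R) * I k' - p * k'%:R * I k'.-1 = (1 - p) * (k' == 0)%:R.
  rewrite /I -!RintegralZl //; try exact: geom_weight_integrable.
  have intZ c j : mu.-integrable `[0, L] (EFin \o (fun x => c * geom_weight j x)).
    have -> : EFin \o (fun x => c * geom_weight j x) =
      (fun x => c%:E * (EFin \o geom_weight j) x)%E by [].
    by apply: integrableZl => //; exact: geom_weight_integrable.
  rewrite -RintegralB //.
  rewrite /Rintegral (@continuous_FTC2 _ _ (antider k') _ _ L_gt0).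
  - rewrite /= /antider /geom_weight geom_param0 geom_param1 subrr mul0r subr0.
    by rewrite /L expr0n mulr1.
  - apply/subspace_continuousP => x xL; apply: cvgB; apply: cvgM; try exact: cvg_cst.
      by have /subspace_continuousP h := geom_weight_continuous (k := k'); exact: h.
    by have /subspace_continuousP h := geom_weight_continuous (k := k'.-1); exact: h.
  - split.
    + move=> x; rewrite in_itv /= => /andP[x0 _].
      by have [] := is_derive_antider k' x0.
    + rewrite /antider mul0r.
      have : x * geom_weight k' x @[x --> 0^'+] --> 0 * geom_weight k' 0.
        apply: cvgM; first exact/cvg_at_right_filter/cvg_id.
        have := geom_weight_continuous (k := k').
        by move/(continuous_within_itvP _ L_gt0) => [].
      by rewrite mul0r.
    + have [+ _] := is_derive_antider k' L_gt0.
      by move/derivable1_diffP/differentiable_continuous; exact: cvg_at_left_filter.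
  - move=> x; rewrite in_itv /= => /andP[x0 _].
    by rewrite derive1E; have [_ ->] := is_derive_antider k' x0.
elim: k => [|k IH].
  apply: (mulfI (lt0r_neq0 (cluster_freq_den p01 0))).
  by rewrite cluster_freqS // -rec /= !mulr0 !mul0r subr0 add0r.
apply: (mulfI (lt0r_neq0 (cluster_freq_den p01 k.+1))).
rewrite cluster_freqS // -IH; have := rec k.+1; rewrite /= => /eqP.
by rewrite subr_eq => /eqP ->; rewrite addrC.
Qed.


(** The series of the definition starts at 1; the term 0 can be added because
    0^a = 0. *)
Lemma geom_momentE a x : 0 < a -> 0 <= x <= L ->
  geom_moment a p x = (\sum_(k <oo) (k%:R `^ a * geom_weight k.-1 x)%:E)%E.
Proof.
move=> a0 xL; have w0 (k : nat) : (0 <= (k%:R `^ a * geom_weight k.-1 x)%:E)%E.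
  by rewrite lee_fin mulr_ge0 ?powR_ge0 // geom_weight_ge0.
rewrite nneseries_recl // powR0 ?lt0r_neq0 // mul0r add0e /geom_moment.
by apply: eq_eseriesr => k _; rewrite /geom_weight mulrA.
Qed.

Lemma swim_constE a : 0 < a -> p * a < 1 ->
  swim_const a p = limn (freq_sum p (fun k => k%:R `^ a)).
Proof.
move=> a0 pa; rewrite /swim_const.
have D x : x \in `[0, L]%classic -> 0 <= x <= L by rewrite inE /= in_itv.
transitivity (fine (\int[mu]_(x in `[0%R, L]) \sum_(k <oo) (k%:R `^ a * geom_weight k.-1 x)%:E)%E).
  by congr fine; apply: eq_integral => x /D xL; exact: geom_momentE.
have intw k : mu.-integrable `[0, L] (fun x => (k%:R `^ a * geom_weight k.-1 x)%:E).
  have -> : (fun x => (k%:R `^ a * geom_weight k.-1 x)%:E) =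
      (fun x => (k%:R `^ a)%:E * (EFin \o geom_weight k.-1) x)%E by [].
  by apply: integrableZl => //; exact: geom_weight_integrable.
rewrite integral_nneseries //; last 2 first.
- by move=> k; exact: measurable_int (intw k).
- by move=> k x xL; rewrite lee_fin mulr_ge0 ?powR_ge0 // geom_weight_ge0 // D // inE.
have E k : (\int[mu]_(x in `[0%R, L]) (k%:R `^ a * geom_weight k.-1 x)%:E)%E =
    (k%:R `^ a * cluster_freq p k)%:E.
  rewrite -[LHS]fineK; last exact: integrable_fin_num.
  congr (_%:E); rewrite -/(Rintegral _ _ _) RintegralZl //; last exact: geom_weight_integrable.
  case: k => [|k]; first by rewrite powR0 ?lt0r_neq0 // !mul0r.
  by rewrite Rintegral_geom_weight.
under eq_eseriesr do rewrite E.
rewrite (_ : (fun n => _) = EFin \o freq_sum p (fun k => k%:R `^ a)).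
  by rewrite EFin_lim //; exact: freq_sum_cvg.
apply/funext => n /=; rewrite /freq_sum -sumEFin big_mkord.
by rewrite sumEFin.
Qed.

End SwimConstant.

(** * Expectations of bounded variables *)

Section BoundedVariables.
Context (R : realType) (disp : measure_display) (T : measurableType disp).
Variable P : probability T R.
Implicit Types f g W X : T -> R.

Definition bounded_rv f :=
  measurable_fun [set: T] f /\ exists M : R, forall w, `|f w| <= M.

Definition mean f : R := \int[P]_w f w.

Lemma bounded_rv_integrable f : bounded_rv f -> P.-integrable setT (EFin \o f).
Proof.
move=> [mf [M fM]]; apply: measurable_bounded_integrable => //.
  exact: le_lt_trans (probability_le1 P measurableT) (ltry 1).
exists M; split; first exact: num_real.
by move=> x Mx w _ /=; exact: le_trans (fM w) (ltW Mx).
Qed.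

Lemma bounded_rv_cst c : bounded_rv (fun=> c).
Proof. by split => //; exists `|c|. Qed.

Lemma bounded_rvD f g : bounded_rv f -> bounded_rv g ->
  bounded_rv (fun w => f w + g w).
Proof.
move=> [mf [M fM]] [mg [N gN]]; split; first exact: measurable_funD.
by exists (M + N) => w; apply: le_trans (ler_normD _ _) _; rewrite lerD.
Qed.

Lemma bounded_rvM f g : bounded_rv f -> bounded_rv g ->
  bounded_rv (fun w => f w * g w).
Proof.
move=> [mf [M fM]] [mg [N gN]]; split; first exact: measurable_funM.
by exists (M * N) => w; rewrite normrM ler_pM.
Qed.

Lemma bounded_rvZ c f : bounded_rv f -> bounded_rv (fun w => c * f w).
Proof. by move=> bf; apply: bounded_rvM => //; exact: bounded_rv_cst. Qed.

Lemma bounded_rvB f g : bounded_rv f -> bounded_rv g ->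
  bounded_rv (fun w => f w - g w).
Proof.
move=> bf bg; apply: bounded_rvD => //.
have -> : (fun w => - g w) = (fun w => -1 * g w).
  by apply/funext => w; rewrite mulN1r.
exact: bounded_rvZ.
Qed.

Lemma bounded_rv_sum (I : Type) (s : seq I) (F : I -> T -> R) :
  (forall i, bounded_rv (F i)) -> bounded_rv (fun w => \sum_(i <- s) F i w).
Proof.
move=> bF; elim: s => [|i s IH].
  by under eq_fun do rewrite big_nil; exact: bounded_rv_cst.
by under eq_fun do rewrite big_cons; exact: bounded_rvD.
Qed.

Lemma bounded_rv_indic (A : set T) : measurable A -> bounded_rv (\1_A).
Proof.
move=> mA; split; first exact: measurable_indic.
by exists 1 => w; rewrite indicE normr_nat lern1 leq_b1.
Qed.

Lemma bounded_rv_comp (g : R -> R) f : measurable_fun setT g ->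
  (exists M, forall x, `|g x| <= M) -> measurable_fun setT f ->
  bounded_rv (fun w => g (f w)).
Proof.
move=> mg [M gM] mf; split; last by exists M.
exact: (measurableT_comp mg mf).
Qed.

Lemma meanD f g : bounded_rv f -> bounded_rv g ->
  mean (fun w => f w + g w) = mean f + mean g.
Proof. by move=> bf bg; apply: RintegralD => //; exact: bounded_rv_integrable. Qed.

Lemma meanB f g : bounded_rv f -> bounded_rv g ->
  mean (fun w => f w - g w) = mean f - mean g.
Proof. by move=> bf bg; apply: RintegralB => //; exact: bounded_rv_integrable. Qed.

Lemma meanZ c f : bounded_rv f -> mean (fun w => c * f w) = c * mean f.
Proof. by move=> bf; apply: RintegralZl => //; exact: bounded_rv_integrable. Qed.

Lemma mean_cst c : mean (fun=> c) = c.
Proof. have PT : fine (P setT) = 1 by have -> : P setT = 1%E := probability_setT P.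
by rewrite /mean Rintegral_cst // [X in _ * X]PT mulr1. Qed.

Lemma mean_sum (I : Type) (s : seq I) (F : I -> T -> R) :
  (forall i, bounded_rv (F i)) ->
  mean (fun w => \sum_(i <- s) F i w) = \sum_(i <- s) mean (F i).
Proof.
move=> bF; elim: s => [|i s IH].
  by rewrite big_nil -[RHS](mean_cst 0); congr mean; apply/funext => w; rewrite big_nil.
rewrite big_cons -IH -meanD //; last exact: bounded_rv_sum.
by congr mean; apply/funext => w; rewrite big_cons.
Qed.

Lemma ler_mean f g : bounded_rv f -> bounded_rv g -> (forall w, f w <= g w) ->
  mean f <= mean g.
Proof.
by move=> bf bg fg; apply: le_Rintegral => //; exact: bounded_rv_integrable.
Qed.

Lemma mean_indic (A : set T) : measurable A -> mean (\1_A) = fine (P A).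
Proof. by move=> mA; rewrite /mean /Rintegral integral_indic // setIT. Qed.

Lemma eq_mean_ae f g : bounded_rv f -> bounded_rv g ->
  {ae P, forall w, f w = g w} -> mean f = mean g.
Proof.
move=> [mf _] [mg _] fg; congr fine; apply: ae_eq_integral => //; try exact/measurable_EFinP.
by apply: filterS fg => w /= ->.
Qed.

Lemma ler_norm_mean f M : bounded_rv f -> (forall w, `|f w| <= M) -> `|mean f| <= M.
Proof.
move=> bf fM; rewrite ler_norml; apply/andP; split.
  rewrite -[leLHS]mean_cst; apply: ler_mean => //; first exact: bounded_rv_cst.
  by move=> w; have := fM w; rewrite ler_norml => /andP[].
rewrite -[leRHS]mean_cst; apply: ler_mean => //; first exact: bounded_rv_cst.
by move=> w; have := fM w; rewrite ler_norml => /andP[].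
Qed.

(** The sum counts the integers of [1, K] below y, that is, the floor of y. *)
Lemma staircase_le (K : nat) (y : R) : 0 <= y < K%:R ->
  `|y - \sum_(k < K) (k.+1%:R <= y)%R%:R| <= 1.
Proof.
elim: K => [|K IH] /andP[y0 yK]; first by have := le_lt_trans y0 yK; rewrite ltxx.
rewrite big_ord_recr /= [K.+1%:R <= y]leNgt yK addr0.
case: (ltP y K%:R) => h; first by apply: IH; rewrite y0.
rewrite (eq_bigr (fun=> 1)); last first.
  by move=> k _; rewrite (le_trans _ h) // ler_nat.
rewrite big_const_ord iter_addr_0 ger0_norm ?subr_ge0 //.
by rewrite lerBlDr addrC natr1 ltW.
Qed.

(** Factorization over events extends to a bounded variable by uniform
    approximation: X is within 1 / (n + 1) of a finite combination of indicators
    of upper level sets, so no limit theorem is needed. *)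
Lemma mean_indep W X : bounded_rv W -> bounded_rv X ->
  (forall A : set R, measurable A ->
     mean (fun w => W w * \1_A (X w)) = mean W * mean (fun w => \1_A (X w))) ->
  mean (fun w => W w * X w) = mean W * mean X.
Proof.
move=> bW bX H; have [_ [M WM]] := bW; have [mX [B XB]] := bX.
have [w0 _] : [set: T] !=set0.
  apply/set0P/eqP => T0; have := probability_setT P.
  by rewrite T0 measure0 => /eqP; rewrite eq_sym onee_eq0.
have M0 : 0 <= M := le_trans (normr_ge0 _) (WM w0).
have B0 : 0 <= B := le_trans (normr_ge0 _) (XB w0).
have bI (A : set R) : measurable A -> bounded_rv (fun w => \1_A (X w)).
  move=> mA; split; first exact: measurableT_comp (measurable_indic mA) mX.
  by exists 1 => w; rewrite indicE normr_nat lern1 leq_b1.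
suff key n : `|mean (fun w => W w * X w) - mean W * mean X| <= 2 * M / n.+1%:R.
  apply/eqP; rewrite -subr_eq0 -normr_le0 leNgt; apply/negP => d0.
  set d := `|_| in key d0.
  have x0 : 0 <= 2 * M / d by rewrite divr_ge0 ?mulr_ge0 // ltW.
  have := archi_boundP x0; rewrite ltr_pdivrMr // [_%:R * d]mulrC => h.
  have := key (Num.bound (2 * M / d)); rewrite ler_pdivlMr //.
  rewrite leNgt => /negP; apply; apply: lt_le_trans h _.
  by rewrite ler_wpM2l ?ler_nat // ltW.
have N0 : 0 < n.+1%:R :> R by [].
have K0 : 0 <= 2 * B * n.+1%:R by rewrite !mulr_ge0.
pose K := Num.bound (2 * B * n.+1%:R).
pose lev k : set R := [set x | k.+1%:R / n.+1%:R - B <= x].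
have mlev k : measurable (lev k).
  have -> : lev k = `[k.+1%:R / n.+1%:R - B, +oo[%classic.
    by apply/seteqP; split => x; rewrite /lev /= in_itv /= andbT.
  exact: measurable_itv.
pose Z w := n.+1%:R^-1 * \sum_(k < K) \1_(lev k) (X w) + (- B).
have bS : bounded_rv (fun w => \sum_(k < K) \1_(lev k) (X w)).
  by apply: bounded_rv_sum => k; exact: bI.
have bZ : bounded_rv Z.
  by apply: bounded_rvD; [exact: bounded_rvZ|exact: bounded_rv_cst].
have XZ w : `|X w - Z w| <= n.+1%:R^-1.
  have /andP[X0 X1] : - B <= X w <= B by rewrite -ler_norml.
  have -> : X w - Z w = n.+1%:R^-1 * (n.+1%:R * (X w + B) -
      \sum_(k < K) (k.+1%:R <= n.+1%:R * (X w + B))%R%:R).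
    rewrite mulrBr mulrA mulVf // mul1r /Z.
    rewrite (eq_bigr (fun k : 'I_K => (k.+1%:R <= n.+1%:R * (X w + B))%R%:R)); first by ring.
    move=> k _; rewrite indicE.
    have -> : (X w \in lev k) = (k.+1%:R / n.+1%:R - B <= X w)%R.
      by apply/idP/idP; rewrite inE.
    by rewrite lerBlDr ler_pdivrMr // [_ * n.+1%:R]mulrC.
  rewrite normrM [X in X * _]ger0_norm ?invr_ge0 // ler_piMr ?invr_ge0 //.
  apply: staircase_le; rewrite mulr_ge0 //=; last by rewrite -lerBlDr sub0r.
  apply: le_lt_trans (archi_boundP K0); rewrite mulrC ler_wpM2r //; lra.
have HZ : mean (fun w => W w * Z w) = mean W * mean Z.
  rewrite /Z [in RHS]meanD ?mean_cst ?meanZ //; last 2 first.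
  - exact: bounded_rvZ.
  - exact: bounded_rv_cst.
  rewrite (_ : (fun w => _) = (fun w => n.+1%:R^-1 *
     (\sum_(k < K) W w * \1_(lev k) (X w)) + (- B) * W w)); last first.
    by apply/funext => w; rewrite -big_distrr /=; ring.
  have bWI k : bounded_rv (fun w => W w * \1_(lev k) (X w)).
    by apply: bounded_rvM => //; exact: bI.
  have bWS : bounded_rv (fun w => \sum_(k < K) W w * \1_(lev k) (X w)).
    by apply: bounded_rv_sum => k; exact: bWI.
  rewrite (meanD (bounded_rvZ _ bWS) (bounded_rvZ _ bW)) !meanZ //.
  rewrite (mean_sum _ (fun k : 'I_K => bWI k)).
  rewrite (mean_sum _ (fun k : 'I_K => bI _ (mlev k))).
  rewrite (eq_bigr (fun k : 'I_K => mean W * mean (fun w => \1_(lev k) (X w)))); last first.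
    by move=> k _; exact: H.
  by rewrite -big_distrr /=; ring.
have bWX := bounded_rvM bW bX; have bWZ := bounded_rvM bW bZ.
have -> : mean (fun w => W w * X w) - mean W * mean X =
   mean (fun w => W w * X w - W w * Z w) - mean W * mean (fun w => X w - Z w).
  by rewrite (meanB bWX bWZ) (meanB bX bZ) HZ; ring.
apply: le_trans (ler_normB _ _) _.
have -> : 2 * M / n.+1%:R = M * n.+1%:R^-1 + M * n.+1%:R^-1 by ring.
apply: lerD.
  apply: ler_norm_mean => [|w]; first exact: bounded_rvB.
  by rewrite -mulrBr normrM ler_pM.
rewrite normrM ler_pM //; first exact: ler_norm_mean.
by apply: ler_norm_mean => //; exact: bounded_rvB.
Qed.

End BoundedVariables.

(** * Characteristic functions of independent sums *)

Section TrigSums.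
Context (R : realType) (disp : measure_display) (T : measurableType disp).
Variable P : probability T R.
Variable a : nat -> T -> R.
Hypothesis ma : forall i, measurable_fun setT (a i).
Implicit Types W : T -> R.
Local Notation mean := (mean P).

(** Joint independence of W and a_0, ..., a_(r-1), when W is the indicator of an
    event.  Allowing a general W makes the notion stable: a factor g (a_r) can be
    absorbed into W ([indep_of_firstM]). *)
Definition indep_of_first (r : nat) W :=
  bounded_rv W /\ forall A : nat -> set R, (forall i, measurable (A i)) ->
  mean (fun w => W w * \prod_(i < r) \1_(A i) (a i w)) =
  mean W * \prod_(i < r) mean (fun w => \1_(A i) (a i w)).

Lemma bounded_rv_indic_comp (X : T -> R) (A : set R) : measurable_fun setT X ->
  measurable A -> bounded_rv (fun w => \1_A (X w) : R).
Proof.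
move=> mX mA; split; first exact: measurableT_comp (measurable_indic mA) mX.
by exists 1 => w; rewrite indicE normr_nat lern1 leq_b1.
Qed.

Lemma bounded_rv_prod_indic r (A : nat -> set R) : (forall i, measurable (A i)) ->
  bounded_rv (fun w => \prod_(i < r) \1_(A i) (a i w) : R).
Proof.
move=> mA; elim: r => [|r IH].
  by under eq_fun do rewrite big_ord0; exact: bounded_rv_cst.
under eq_fun do rewrite big_ord_recr /=.
by apply: bounded_rvM => //; exact: bounded_rv_indic_comp.
Qed.

Lemma indep_of_firstM r W (g : R -> R) : indep_of_first r.+1 W ->
  measurable_fun setT g -> (exists M, forall x, `|g x| <= M) ->
  indep_of_first r (fun w => W w * g (a r w)) /\
  mean (fun w => W w * g (a r w)) = mean W * mean (fun w => g (a r w)).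
Proof.
move=> [bW iW] mg gM.
have bg : bounded_rv (fun w => g (a r w)) by exact: bounded_rv_comp.
have key (A : nat -> set R) : (forall i, measurable (A i)) ->
    mean (fun w => W w * \prod_(i < r) \1_(A i) (a i w) * g (a r w)) =
    mean W * \prod_(i < r) mean (fun w => \1_(A i) (a i w)) * mean (fun w => g (a r w)).
  move=> mA.
  have iA (B : set R) : measurable B -> mean (fun w =>
      W w * \prod_(i < r) \1_(A i) (a i w) * \1_B (a r w)) =
      mean W * \prod_(i < r) mean (fun w => \1_(A i) (a i w)) * mean (fun w => \1_B (a r w)).
    move=> mB; have := iW (fun i => if i == r then B else A i).
    rewrite big_ord_recr /= eqxx.
    under [in X in _ = _ * (X * _)]eq_bigr => i _ do rewrite (ltn_eqF (ltn_ord i)).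
    rewrite [in RHS]mulrA => <-; last by move=> i; case: ifP.
    congr mean; apply/funext => w; rewrite big_ord_recr /= eqxx mulrA; congr (_ * _ * _).
    by apply: eq_bigr => i _; rewrite (ltn_eqF (ltn_ord i)).
  have EW : mean (fun w => W w * \prod_(i < r) \1_(A i) (a i w)) =
      mean W * \prod_(i < r) mean (fun w => \1_(A i) (a i w)).
    have := iA setT measurableT.
    rewrite (_ : (fun w => \1_setT (a r w)) = fun=> 1); last first.
      by apply/funext => w; rewrite indicT.
    rewrite mean_cst mulr1 => <-.
    by congr mean; apply/funext => w; rewrite indicT mulr1.
  rewrite -EW; apply: mean_indep => //.
    by apply: bounded_rvM => //; exact: bounded_rv_prod_indic.
  move=> B mB; have := iA (g @^-1` B); rewrite EW => <-; last first.
    by rewrite -[_ @^-1` _]setTI; exact: mg.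
  by congr mean; apply/funext => w; congr (_ * _); rewrite !indicE; congr (_%:R).
have Eg : mean (fun w => W w * g (a r w)) = mean W * mean (fun w => g (a r w)).
  have := key (fun=> setT) (fun=> measurableT).
  rewrite [X in _ * X * _]big1; last first.
    by move=> i _; under eq_fun do rewrite indicT; rewrite mean_cst.
  rewrite mulr1 => <-; congr mean; apply/funext => w.
  by rewrite big1 ?mulr1 // => i _; rewrite indicT.
split => //; split; first exact: bounded_rvM.
move=> A mA; rewrite Eg mulrAC -key //.
by congr mean; apply/funext => w; rewrite mulrAC.
Qed.

Lemma cos_measurable : measurable_fun setT (@cos R).
Proof. by apply: continuous_measurable_fun; exact: continuous_cos. Qed.

Lemma sin_measurable : measurable_fun setT (@sin R).
Proof. by apply: continuous_measurable_fun; exact: continuous_sin. Qed.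

(** By the addition formulas, one variable at a time: the terms with a sine of the
    last variable vanish. *)
Lemma mean_trig_sum r W : indep_of_first r W ->
  (forall i, (i < r)%N -> mean (fun w => sin (a i w)) = 0) ->
  mean (fun w => W w * cos (\sum_(i < r) a i w)) =
    mean W * \prod_(i < r) mean (fun w => cos (a i w)) /\
  mean (fun w => W w * sin (\sum_(i < r) a i w)) = 0.
Proof.
elim: r W => [|r IH] W iW s0.
  split.
    rewrite big_ord0 mulr1; congr mean; apply/funext => w.
    by rewrite big_ord0 cos0 mulr1.
  rewrite -[RHS](mean_cst P); congr mean; apply/funext => w.
  by rewrite big_ord0 sin0 mulr0.
have cM : exists M : R, forall x, `|cos x| <= M by exists 1; exact: cos_max.
have sM : exists M : R, forall x, `|sin x| <= M by exists 1; exact: sin_max.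
have [ic Ec] := indep_of_firstM iW cos_measurable cM.
have [is' Es] := indep_of_firstM iW sin_measurable sM.
have s0' i : (i < r)%N -> mean (fun w => sin (a i w)) = 0 by move=> ir; apply: s0; exact: ltnW.
have [cc cs] := IH _ ic s0'; have [sc ss] := IH _ is' s0'.
have mS : measurable_fun setT (fun w => \sum_(i < r) a i w) by exact: measurable_sum.
have b1 V : bounded_rv V -> bounded_rv (fun w => V w * cos (\sum_(i < r) a i w)).
  by move=> bV; apply: bounded_rvM => //; apply: bounded_rv_comp => //; exact: cos_measurable.
have b2 V : bounded_rv V -> bounded_rv (fun w => V w * sin (\sum_(i < r) a i w)).
  by move=> bV; apply: bounded_rvM => //; apply: bounded_rv_comp => //; exact: sin_measurable.
have [bc _] := ic; have [bs _] := is'.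
split.
  rewrite (_ : (fun w => _) = (fun w => W w * cos (a r w) * cos (\sum_(i < r) a i w)
     - W w * sin (a r w) * sin (\sum_(i < r) a i w))); last first.
    by apply/funext => w; rewrite big_ord_recr /= cosD; ring.
  by rewrite meanB ?cc ?ss ?Ec; [rewrite subr0 big_ord_recr /= mulrAC mulrA|exact: b1|exact: b2].
rewrite (_ : (fun w => _) = (fun w => W w * cos (a r w) * sin (\sum_(i < r) a i w)
   + W w * sin (a r w) * cos (\sum_(i < r) a i w))); last first.
  by apply/funext => w; rewrite big_ord_recr /= sinD; ring.
by rewrite meanD ?cs ?sc ?Es ?s0 ?mulr0 ?mul0r ?addr0 //; [exact: b2|exact: b1].
Qed.

End TrigSums.

(** * Borel sets of row vectors *)

Section BorelRow.
Context (R : realType) (d : nat).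
Implicit Types (x y : 'rV[R]_d).

Lemma continuous_row_measurable (f : 'rV[R]_d -> R) :
  continuous f -> measurable_fun [set: 'rV[R]_d] f.
Proof.
move=> cf; apply: (measurability _ (RGenOpens.measurableE R)).
move=> _ [_ [a [b ->] <-]]; rewrite setTI; apply: sub_sigma_algebra.
by move/continuousP : cf; apply; exact: interval_open.
Qed.

(** An open set is a countable union of cubes with rational centres, whose
    preimages are finite intersections of preimages of intervals. *)
Lemma row_measurable (disp : measure_display) (T : measurableType disp)
    (X : T -> 'rV[R]_d) : (forall i, measurable_fun [set: T] (fun w => X w ord0 i)) ->
  measurable_fun [set: T] X.
Proof.
move=> mX; apply: (@measurability _ _ _ _ _ _ (@open 'rV[R]_d)) => [//|_ [V oV <-]]; rewrite setTI.
pose box (q : 'rV[rat]_d) (k : nat) : set 'rV[R]_d :=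
  [set x | forall i, `|x ord0 i - ratr (q ord0 i)| < k.+1%:R^-1].
pose F (qk : 'rV[rat]_d * nat) : set T :=
  if `[< box qk.1 qk.2 `<=` V >] then X @^-1` box qk.1 qk.2 else set0.
have -> : X @^-1` V = \bigcup_qk F qk.
  apply/seteqP; split => w /=; last first.
    by move=> [[q k] _]; rewrite /F; case: asboolP => //= bV; exact: bV.
  move=> Vw; have /nbhs_ballP[e e0 eV] : nbhs (X w) V by exact: open_nbhs_nbhs.
  have e20 : 0 <= 2 / e by rewrite divr_ge0 // ltW.
  pose k := Num.bound (2 / e).
  have ke : 2 * k.+1%:R^-1 < e.
    have := archi_boundP e20; rewrite -/k ltr_pdivrMr // => h.
    by rewrite ltr_pdivrMr // (lt_le_trans h) // mulrC ler_pM2l // ler_nat.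
  have k0 : 0 < k.+1%:R^-1 :> R by rewrite invr_gt0.
  have /choice[q hq] i : exists q : rat, `|X w ord0 i - ratr q| < k.+1%:R^-1.
    have /rat_in_itvoo[q] : X w ord0 i - k.+1%:R^-1 < X w ord0 i + k.+1%:R^-1.
      by rewrite ltrBlDr -addrA ltrDl addr_gt0.
    rewrite in_itv /= => /andP[q1 q2]; exists q.
    by rewrite ltr_distlC q1.
  exists (\row_i q i, k) => //; rewrite /F; case: asboolP => /= [_ i|].
    by rewrite mxE.
  case=> x bx; apply: eV; split => // i0 i; rewrite (ord1 i0) /ball /=.
  have := bx i; rewrite mxE => h1; have h2 := hq i.
  rewrite -(subrKA (ratr (q i))); apply: le_lt_trans (ler_normD _ _) _.
  apply: lt_trans ke; rewrite mulrDl mul1r; apply: ltrD => //.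
  by rewrite distrC.
apply: countable_bigcupT_measurable => [|[q k]]; first exact: countableP.
rewrite /F; case: asboolP => //= _.
have -> : X @^-1` box q k = \bigcap_(i in [set: 'I_d])
    ((fun w => X w ord0 i) @^-1` [set y | `|y - ratr (q ord0 i)| < k.+1%:R^-1]).
  by apply/seteqP; split => w /= h i; [move=> _|]; exact: h.
apply: fin_bigcap_measurable => // i _; rewrite -[_ @^-1` _]setTI; apply: mX => //.
have -> : [set y : R | `|y - ratr (q ord0 i)| < k.+1%:R^-1] = ball (ratr (q ord0 i) : R) k.+1%:R^-1.
  by apply/seteqP; split => y /=; rewrite /ball /= distrC.
by apply: open_measurable; exact: ball_open.
Qed.

Lemma dotp_continuous (theta : 'rV[R]_d) : continuous (dotp theta).
Proof.
apply: (@continuous_big R 'I_d +%R 0 xpredT) => [|i _ x].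
  by move=> x; apply: cvgD; [exact: cvg_fst|exact: cvg_snd].
have := @cvgM R _ (nbhs x) _ (cst (theta ord0 i)) (fun z : 'rV[R]_d => z ord0 i)
  _ _ (cvg_cst _) (@coord_continuous R 1 d ord0 i x).
exact.
Qed.

Lemma dotp_measurable (disp : measure_display) (T : measurableType disp)
    (theta : 'rV[R]_d) (X : T -> 'rV[R]_d) : measurable_fun [set: T] X ->
  measurable_fun [set: T] (fun w => dotp theta (X w)).
Proof.
move=> mX; apply: (measurableT_comp _ mX).
by apply: continuous_row_measurable; exact: dotp_continuous.
Qed.

Lemma dotpDr (theta x y : 'rV[R]_d) : dotp theta (x + y) = dotp theta x + dotp theta y.
Proof.
by rewrite /dotp -big_split /=; apply: eq_bigr => i _; rewrite mxE mulrDr.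
Qed.

Lemma dotpZr (theta x : 'rV[R]_d) c : dotp theta (c *: x) = c * dotp theta x.
Proof.
by rewrite /dotp big_distrr /=; apply: eq_bigr => i _; rewrite mxE mulrCA.
Qed.

Lemma dotpZl (theta x : 'rV[R]_d) c : dotp (c *: theta) x = c * dotp theta x.
Proof.
by rewrite /dotp big_distrr /=; apply: eq_bigr => i _; rewrite mxE mulrA.
Qed.

Lemma dotp0r (theta : 'rV[R]_d) : dotp theta 0 = 0.
Proof. by rewrite /dotp big1 // => i _; rewrite mxE mulr0. Qed.

Lemma enormZ (theta : 'rV[R]_d) c : enorm (c *: theta) = `|c| * enorm theta.
Proof.
by rewrite /enorm dotpZl dotpZr mulrA -expr2 sqrtrM ?sqr_ge0 // sqrtr_sqr.
Qed.

End BorelRow.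

(** * From the swim to the chain of labels *)

Section SwimLaw.
Context (R : realType) (d : nat) (alpha p : R).
Hypothesis p01 : 0 < p < 1.
Context (disp : measure_display) (T : measurableType disp) (P : probability T R).
Variables (xi : nat -> {RV P >-> 'rV[R]_d}) (coin : nat -> {RV P >-> bool}).
Variables (U : nat -> {RV P >-> nat}) (Y : nat -> {RV P >-> 'rV[R]_d}).
Hypothesis hswim : shark_random_swim alpha p xi coin U Y.
Local Notation mean := (mean P).
Local Notation index := ((nat + nat) + nat)%type.

(** Indicators of intersections of events about distinct variables of the family;
    building them one event at a time keeps track of which variables remain free. *)
Inductive event_product : seq index -> (T -> R) -> Prop :=
| EventNil : event_product [::] (fun=> 1)
| EventCons k A s W : k \notin s -> swim_index k ->
    swim_events xi coin U k A -> event_product s W ->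
    event_product (k :: s) (fun w => \1_A w * W w).

Lemma swim_event_measurable k A : swim_events xi coin U k A -> measurable A.
Proof.
by case: k => [[i|n]|n] /= [B mB <-]; rewrite setTI; exact: measurable_funPTI.
Qed.

Lemma swim_eventT k : swim_events xi coin U k setT.
Proof.
by case: k => [[i|n]|n] /=; exists setT => //; rewrite setTI preimage_setT.
Qed.

Lemma event_product_bounded s W : event_product s W -> bounded_rv W.
Proof.
elim=> [|k A {}s {}W _ _ /swim_event_measurable mA _ bW].
  exact: bounded_rv_cst.
by apply: bounded_rvM => //; exact: bounded_rv_indic.
Qed.

Lemma event_productE s W : event_product s W ->
  [/\ uniq s, {in s, forall k, swim_index k} &
   exists E : index -> set T, (forall k, swim_events xi coin U k (E k)) /\
     W = (fun w => \prod_(k <- s) \1_(E k) w)].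
Proof.
elim=> [|k A {}s {}W ks Dk FA _ [us Ds [E [FE ->]]]].
  split => //; exists (fun=> setT); split; first exact: swim_eventT.
  by apply/funext => w; rewrite big_nil.
split => /=; first by rewrite ks.
  by move=> k'; rewrite inE => /predU1P[->//|/Ds].
exists (fun k' => if k' == k then A else E k'); split.
  by move=> k'; case: eqP => // ->.
apply/funext => w; rewrite big_cons eqxx; congr (_ * _).
by apply: eq_big_seq => k' k's; case: eqP => // kk; rewrite -kk k's in ks.
Qed.

(** Mutual independence is assumed for finite sets of indices, which lists without
    duplicates represent. *)
Lemma mean_prod_events s (E : index -> set T) : uniq s ->
  {in s, forall k, swim_index k} -> (forall k, swim_events xi coin U k (E k)) ->
  mean (fun w => \prod_(k <- s) \1_(E k) w) = \prod_(k <- s) mean (\1_(E k)).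
Proof.
move=> us Ds FE; pose J : {fset index} := [fset k | k in s]%fset.
have Js : perm_eq J s.
  by apply: uniq_perm => // k; rewrite inE.
have mE k : measurable (E k) by exact: swim_event_measurable.
have -> : (fun w => \prod_(k <- s) \1_(E k) w : R) = \1_(\bigcap_(k in [set` J]) E k).
  apply/funext => w; rewrite indicE; case: (boolP (w \in _)) => [|wE].
    rewrite inE => wE; rewrite big1_seq // => k /andP[_ ks].
    by rewrite indicE mem_set //; apply: wE; rewrite /= inE.
  apply/eqP; rewrite prodf_seq_eq0; apply/hasP.
  have [k Jk wk] : exists2 k, k \in J & w \notin E k.
    apply: contrapT => nk; move/negP: wE; apply; rewrite inE => k Jk.
    by rewrite -in_setE; apply: contrapT => /negP wk; apply: nk; exists k.
  exists k; first by move: Jk; rewrite inE.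
  by rewrite /= indicE (negbTE wk).
rewrite mean_indic; last first.
  by apply: fin_bigcap_measurable => //; exact: finite_fset.
have -> := swim_indep hswim (J := J) (E := E); last 2 first.
- by move=> k; rewrite /= inE => /Ds.
- by move=> k _.
by rewrite (perm_big _ Js) /=; apply: eq_bigr => k _; rewrite mean_indic.
Qed.

Lemma mean_event_product k A s W : k \notin s -> swim_index k ->
  swim_events xi coin U k A -> event_product s W ->
  mean (fun w => \1_A w * W w) = mean (\1_A) * mean W.
Proof.
move=> ks Dk FA epW; have epAW := EventCons ks Dk FA epW.
have [us Ds [E [FE EW]]] := event_productE epW.
pose E' k' := if k' == k then A else E k'.
have E's : {in s, forall k', E' k' = E k'}.
  by move=> k' k's; rewrite /E'; case: eqP => // kk; rewrite -kk k's in ks.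
have FE' k' : swim_events xi coin U k' (E' k') by rewrite /E'; case: eqP => // ->.
have -> : (fun w => \1_A w * W w) = fun w => \prod_(k' <- k :: s) \1_(E' k') w.
  apply/funext => w; rewrite big_cons /E' eqxx EW; congr (_ * _).
  by apply: eq_big_seq => k' /E's; rewrite /E' => ->.
rewrite mean_prod_events //=; last 2 first.
- by rewrite ks.
- by move=> k'; rewrite inE => /predU1P[->//|/Ds].
rewrite big_cons /E' eqxx; congr (_ * _).
rewrite EW mean_prod_events //.
by apply: eq_big_seq => k' /E's; rewrite /E' => ->.
Qed.


(** Lists of labels are newest first, whereas ranks count from the oldest step,
    which has rank 0. *)
Definition label (r : seq nat) (i : nat) : nat := nth 0%N r (size r - i.+1).

Lemma label_old x r i : (i < size r)%N -> label (x :: r) i = label r i.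
Proof. by move=> ir; rewrite /label /= subSn. Qed.

Lemma label_last x r : label (x :: r) (size r) = x.
Proof. by rewrite /label /= subnn. Qed.

Lemma sum_label (h : nat -> R) r :
  \sum_(x <- r) h x = \sum_(u < size r) h (label r u).
Proof.
rewrite (big_nth 0%N) big_mkord (reindex_inj rev_ord_inj) /=.
by [].
Qed.

(** The coefficient of xi_(j+1) in the combination of steps and innovations with
    coefficients k and l, when the labels of the steps are r. *)
Definition step_weight (l k : nat -> nat) (r : seq nat) (j : nat) : nat :=
  (l j + \sum_(i < size r) (label r i == j.+1) * k i)%N.

Lemma step_weight_cons l k x r j :
  step_weight l k (x :: r) j = (step_weight l k r j + (x == j.+1) * k (size r))%N.
Proof.
rewrite /step_weight /= big_ord_recr /= label_last addnA; congr (_ + _ + _)%N.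
by apply: eq_bigr => i _; rewrite label_old.
Qed.

(** Resolving the newest step moves its coefficient, to its own innovation here,
    and to the copied step in [step_weight_copy]. *)
Lemma step_weight_new l k r :
  step_weight l k ((size r).+1 :: r) =
  step_weight (fun j => l j + (j == size r) * k (size r))%N k r.
Proof.
by apply/funext => j; rewrite step_weight_cons /step_weight eqSS eq_sym addnAC.
Qed.

Lemma step_weight_copy l k r u : (u < size r)%N ->
  step_weight l k (label r u :: r) =
  step_weight l (fun i => k i + (i == u) * k (size r))%N r.
Proof.
move=> ur; apply/funext => j; rewrite step_weight_cons /step_weight -addnA; congr (_ + _)%N.
under [in RHS]eq_bigr do rewrite mulnDr.
rewrite big_split /=; congr (_ + _)%N.
rewrite (bigD1 (Ordinal ur)) //= eqxx mul1n big1 ?addn0 // => i.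
by rewrite -val_eqE /= => /negbTE ->; rewrite mul0n muln0.
Qed.

Lemma sum_bump (m j c : nat) (l : nat -> nat) (x : nat -> R) : (j < m)%N ->
  \sum_(i < m) (l i + (i == j :> nat) * c)%:R * x i =
  \sum_(i < m) (l i)%:R * x i + c%:R * x j.
Proof.
move=> jm; under eq_bigr do rewrite natrD mulrDl.
rewrite big_split /=; congr (_ + _).
rewrite (bigD1 (Ordinal jm)) //= eqxx mul1n big1 ?addr0 // => i.
by rewrite -val_eqE /= => /negbTE ->; rewrite mul0n mul0r.
Qed.

(** The coins and choices made after time n + 1, on which neither the first
    n + 1 steps nor the innovations depend. *)
Definition later_choice (n : nat) (k : index) : bool :=
  match k with
  | inl (inl _) => false
  | inl (inr j) => (n.+1 < j)%N
  | inr j => (n.+1 < j)%N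
  end.

Lemma coin_event b n : swim_events xi coin U (inl (inr n)) (coin n @^-1` [set b]).
Proof. by exists [set b] => //; rewrite setTI. Qed.

Lemma choice_event k n : swim_events xi coin U (inr n) (U n @^-1` [set k]).
Proof. by exists [set k] => //; rewrite setTI. Qed.

Lemma mean_coin_true n : (1 < n)%N -> mean (\1_(coin n @^-1` [set true])) = p.
Proof.
move=> n1; rewrite mean_indic ?(swim_coin hswim) //.
exact: (swim_event_measurable (coin_event true n)).
Qed.

Lemma mean_coin_false n : (1 < n)%N -> mean (\1_(coin n @^-1` [set false])) = 1 - p.
Proof.
move=> n1; rewrite -(mean_coin_true n1) -(mean_cst P 1) -meanB; last 2 first.
- exact: bounded_rv_cst.
- by apply: bounded_rv_indic; exact: (swim_event_measurable (coin_event true n)).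
congr mean; apply/funext => w; rewrite !indicE.
have E b : (w \in coin n @^-1` [set b]) = (coin n w == b).
  by apply/idP/eqP; rewrite inE.
by rewrite !E; case: (coin n w); rewrite /= ?subrr ?subr0.
Qed.

Lemma mean_choice n u : (u < n.+1)%N ->
  mean (\1_(U n.+2 @^-1` [set u.+1])) = n.+1%:R^-1.
Proof.
move=> un; rewrite mean_indic ?(swim_uniform hswim) //.
exact: (swim_event_measurable (choice_event u.+1 n.+2)).
Qed.

(** The values 1, ..., n + 1 already exhaust the probability. *)
Lemma choice_in_range n :
  {ae P, forall w, exists u : 'I_n.+1, U n.+2 w = u.+1}.
Proof.
pose B := U n.+2 @^-1` [set k | (0 < k <= n.+1)%N].
have mB : measurable B by exact: measurable_funPTI.
exists (~` B); split; first exact: measurableC.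
  have := probability_setC P mB => ->.
  suff PB : P B = 1%E by rewrite PB subee.
  rewrite -[LHS]fineK ?fin_num_measure // -mean_indic //.
  have -> : \1_B = (fun w => \sum_(u < n.+1) \1_(U n.+2 @^-1` [set u.+1]) w) :> (T -> R).
    apply/funext => w; rewrite indicE.
    have E (u : 'I_n.+1) : \1_(U n.+2 @^-1` [set u.+1]) w = (U n.+2 w == u.+1)%:R :> R.
      by rewrite indicE; congr (nat_of_bool _)%:R; apply/idP/eqP; rewrite inE.
    under eq_bigr do rewrite E.
    case: (boolP (w \in B)) => [|wB].
      rewrite inE /B /=; case EU: (U n.+2 w) => [//|u] /= un.
      rewrite (bigD1 (Ordinal (un : (u < n.+1)%N))) //= eqxx big1 ?addr0 // => i.
      by rewrite -val_eqE /= eqSS eq_sym => /negbTE ->.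
    rewrite big1 // => u _; case: eqP => // Uu; move: wB.
    by rewrite notin_setE /B /= Uu /= ltn_ord.
  rewrite mean_sum => [|u]; last first.
    by apply: bounded_rv_indic; exact: (swim_event_measurable (choice_event u.+1 n.+2)).
  under eq_bigr do rewrite mean_choice //.
  by rewrite big_const_ord iter_addr_0 -[_^-1 *+ _]mulr_natr mulVf // pnatr_eq0.
move=> w; apply: contra_not; rewrite /B /=; case EU: (U n.+2 w) => [|u] // un.
by exists (Ordinal (un : (u < n.+1)%N)).
Qed.

Section Recursion.
Variables (m : nat) (theta : 'rV[R]_d) (phi : R -> R) (kappa : (nat -> nat) -> R).
Hypothesis mphi : measurable_fun [set: R] phi.
Hypothesis phiM : exists M, forall x, `|phi x| <= M.
Let x i w := dotp theta (xi i.+1 w).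
Let y i w := dotp theta (Y i.+1 w).
(** The function phi is meant to be the cosine or the sine. *)
Hypothesis base : forall s W (l : nat -> nat), event_product s W -> all (later_choice 0) s ->
  mean (fun w => W w * phi (\sum_(i < m) (l i)%:R * x i w)) = mean W * kappa l.

Let bphi (n : nat) (k l : nat -> nat) :
  bounded_rv (fun w => phi (\sum_(i < n) (k i)%:R * y i w
                            + \sum_(i < m) (l i)%:R * x i w)).
Proof.
apply: bounded_rv_comp => //; apply: measurable_funD; apply: measurable_sum => i;
  apply: measurable_funM => //; apply: dotp_measurable; exact: measurable_funPT.
Qed.

(** Induction on the time, for all coefficients at once: according to the coin and
    the choice at the last time, the last step is replaced by an innovation or an
    earlier step, which only changes the coefficients.  The factor W carries the
    events already used. *)
Lemma swim_mean_recursion n : (n < m)%N ->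
  forall (k l : nat -> nat) s W, event_product s W -> all (later_choice n) s ->
  mean (fun w => W w * phi (\sum_(i < n.+1) (k i)%:R * y i w
                            + \sum_(i < m) (l i)%:R * x i w)) =
  mean W * swim_mean p n (fun r => kappa (step_weight l k r)).
Proof.
elim: n => [|n IH] nm k l s W epW ls.
  have bW := event_product_bounded epW.
  pose l' j := (l j + (j == 0)%N * k 0)%N.
  have -> : swim_mean p 0 (fun r => kappa (step_weight l k r)) = kappa l'.
    rewrite /=; congr kappa; apply/funext => j.
    by rewrite /step_weight big_ord1 /= /label /= eqSS eq_sym.
  rewrite -(base l' epW ls); apply: eq_mean_ae.
  - by apply: bounded_rvM => //; exact: bphi.
  - apply: bounded_rvM => //; have := bphi 0 (fun=> 0%N) l'.
    by congr bounded_rv; apply/funext => w; rewrite big_ord0 add0r.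
  have := swim_Y1 hswim; apply: filterS => w Y1.
  rewrite big_ord1 /l' (@sum_bump m 0 (k 0%N) l (fun i => x i w)) //.
  by rewrite /y Y1 addrC.
have bW := event_product_bounded epW.
pose c b : T -> R := \1_(coin n.+2 @^-1` [set b]).
pose v (u : 'I_n.+1) : T -> R := \1_(U n.+2 @^-1` [set u.+1]).
pose l0 j := (l j + (j == n.+1)%N * k n.+1)%N.
pose ku (u : 'I_n.+1) i := (k i + (i == u :> nat) * k n.+1)%N.
pose F (k l : nat -> nat) w :=
  phi (\sum_(i < n.+1) (k i)%:R * y i w + \sum_(i < m) (l i)%:R * x i w).
have bF k' l' : bounded_rv (F k' l') by exact: bphi.
have fresh j : j \in s -> later_choice n.+1 j by move=> js; exact: (allP ls).
have ncoin : inl (inr n.+2) \notin s by apply/negP => /fresh /=; rewrite ltnn.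
have nch : inr n.+2 \notin s by apply/negP => /fresh /=; rewrite ltnn.
have ls' : all (later_choice n) s.
  by apply/allP => -[[j|j]|j] /fresh //=; exact: ltnW.
have ep0 := @EventCons (inl (inr n.+2)) _ _ _ ncoin isT (coin_event false n.+2) epW.
have epv (u : 'I_n.+1) := @EventCons (inr n.+2) _ _ _ nch isT (choice_event u.+1 n.+2) epW.
have nch' : inl (inr n.+2) \notin inr n.+2 :: s by rewrite inE.
have ep1 u := @EventCons (inl (inr n.+2)) _ _ _ nch' isT (coin_event true n.+2) (epv u).
have nm' := ltnW nm.
have -> : mean (fun w => W w * phi (\sum_(i < n.+2) (k i)%:R * y i w
                            + \sum_(i < m) (l i)%:R * x i w)) =
  mean (fun w => (c false w * W w) * F k l0 w
     + \sum_(u < n.+1) (c true w * (v u w * W w)) * F (ku u) l w).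
  apply: eq_mean_ae.
  - by apply: bounded_rvM => //; exact: bphi.
  - apply: bounded_rvD; last apply: bounded_rv_sum => u.
      by apply: bounded_rvM => //; exact: (event_product_bounded ep0).
    by apply: bounded_rvM => //; exact: (event_product_bounded (ep1 u)).
  apply: filterS2 (swim_YS hswim (isT : (2 <= n.+2)%N)) (choice_in_range n) => w Yw [u Uw].
  have cE b : c b w = (coin n.+2 w == b)%:R.
    by rewrite /c indicE; congr (nat_of_bool _)%:R; apply/idP/eqP; rewrite inE.
  have vE u' : v u' w = (u == u')%:R.
    rewrite /v indicE -val_eqE -eqSS -Uw; congr (nat_of_bool _)%:R.
    by apply/idP/eqP; rewrite inE.
  rewrite big_ord_recr /= {2}/y Yw !cE; case: (coin n.+2 w) => /=.
    rewrite [in RHS](bigD1 u) //= vE eqxx [in RHS]big1 ?addr0; last first.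
      by move=> u' /negbTE u'u; rewrite vE eq_sym u'u mul0r mulr0 mul0r.
    rewrite !mul0r add0r !mul1r; congr (_ * _).
    by rewrite /F /ku (@sum_bump n.+1 u (k n.+1) k (fun i => y i w)) // /y Uw.
  rewrite [in RHS]big1 ?addr0; last by move=> u1 _; rewrite mul0r mul0r.
  rewrite mul1r; congr (_ * _).
  rewrite /F /l0 (@sum_bump m n.+1 (k n.+1) l (fun i => x i w)) //.
  by congr phi; rewrite -addrA; congr (_ + _); rewrite addrC.
rewrite meanD; last 2 first.
- by apply: bounded_rvM => //; exact: (event_product_bounded ep0).
- apply: bounded_rv_sum => u.
  by apply: bounded_rvM => //; exact: (event_product_bounded (ep1 u)).
rewrite mean_sum; last first.
  by move=> u; apply: bounded_rvM => //; exact: (event_product_bounded (ep1 u)).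
rewrite (IH nm' _ _ _ _ ep0) /=; last by rewrite ltnSn.
rewrite (mean_event_product ncoin isT (coin_event false n.+2) epW) mean_coin_false //.
rewrite (eq_bigr (fun u : 'I_n.+1 => mean W * (p / n.+1%:R *
    swim_mean p n (fun r => kappa (step_weight l (ku u) r))))); last first.
  move=> u _; rewrite (IH nm' _ _ _ _ (ep1 u)) /=; last by rewrite !ltnSn.
  rewrite (mean_event_product nch' isT (coin_event true n.+2) (epv u)) mean_coin_true //.
  rewrite (mean_event_product nch isT (choice_event u.+1 n.+2) epW) mean_choice //.
  by ring.
rewrite -big_distrr -mulrA mulrCA -mulrDr; congr (_ * _).
rewrite -swim_meanZ //.
under eq_bigr do rewrite -swim_meanZ //.
rewrite -swim_mean_sum // -swim_meanD //=; apply: eq_swim_mean => // r /andP[/eqP sr _].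
rewrite sum_label -big_distrr /=; congr (_ * _ + _ * _).
  by rewrite -[n.+2]/(n.+1.+1) -sr step_weight_new sr.
by rewrite sr; apply: eq_bigr => u _; rewrite step_weight_copy ?sr.
Qed.

End Recursion.

End SwimLaw.

(** * The characteristic function of the swim *)

Section SwimCharacteristic.
Context (R : realType) (d : nat) (alpha p : R).
Hypothesis p01 : 0 < p < 1.
Hypothesis alpha0 : 0 < alpha.
Context (disp : measure_display) (T : measurableType disp) (P : probability T R).
Variables (xi : nat -> {RV P >-> 'rV[R]_d}) (coin : nat -> {RV P >-> bool}).
Variables (U : nat -> {RV P >-> nat}) (Y : nat -> {RV P >-> 'rV[R]_d}).
Hypothesis hswim : shark_random_swim alpha p xi coin U Y.
Local Notation mean := (mean P).
Local Notation index := ((nat + nat) + nat)%type.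
Local Notation event_product := (event_product xi coin U).

Lemma mean_step_ident (g : 'rV[R]_d -> R) i : (0 < i)%N ->
  measurable_fun [set: 'rV[R]_d] g -> (exists M, forall x, `|g x| <= M) ->
  mean (fun w => g (xi i w)) = mean (fun w => g (xi 1%N w)).
Proof.
move=> i0 mg [M gM]; rewrite /mean /Rintegral; congr fine.
have int j : P.-integrable setT ((EFin \o g) \o xi j).
  apply: (@bounded_rv_integrable _ _ _ P (fun w => g (xi j w))).
  by split; [exact: measurableT_comp mg (measurable_funPT (xi j))|exists M].
have mg' : measurable_fun [set: 'rV[R]_d] (EFin \o g) by exact/measurable_EFinP.
have := integral_distribution mg' (int i); rewrite /= => <-.
have := integral_distribution mg' (int 1%N); rewrite /= => <-.
by apply: eq_measure_integral => A mA _; exact: (swim_xi_ident hswim i0 mA).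
Qed.

Lemma mean_trig_step (theta : 'rV[R]_d) i (c : R) : (0 < i)%N ->
  mean (fun w => cos (c * dotp theta (xi i w)))
    = expR (- ((`|c| * enorm theta) `^ alpha)) /\
  mean (fun w => sin (c * dotp theta (xi i w))) = 0.
Proof.
move=> i0; have mphi (g : R -> R) : continuous g ->
    measurable_fun [set: 'rV[R]_d] (fun x => g (c * dotp theta x)).
  move=> cg; apply: (measurableT_comp (continuous_measurable_fun cg)).
  apply: measurable_funM => //.
  by apply: continuous_row_measurable; exact: dotp_continuous.
have := swim_xi_charfun hswim (c *: theta); rewrite /charfun enormZ => -[hc hs].
split.
  rewrite (@mean_step_ident (fun x => cos (c * dotp theta x)) _ i0).
  - by rewrite -hc; congr mean; apply/funext => w; rewrite dotpZl.
  - by apply: mphi; exact: continuous_cos.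
  - by exists 1 => x; exact: cos_max.
rewrite (@mean_step_ident (fun x => sin (c * dotp theta x)) _ i0).
- by rewrite -hs; congr mean; apply/funext => w; rewrite dotpZl.
- by apply: mphi; exact: continuous_sin.
- by exists 1 => x; exact: sin_max.
Qed.

Section Base.
Variables (m : nat) (theta : 'rV[R]_d) (l : nat -> nat).
Let a i w := (l i)%:R * dotp theta (xi i.+1 w).

Let ma i : measurable_fun [set: T] (a i).
Proof.
by apply: measurable_funM => //; apply: dotp_measurable; exact: measurable_funPT.
Qed.

Let step_event i (A : set R) : measurable A ->
  swim_events xi coin U (inl (inl i.+1)) (a i @^-1` A).
Proof.
move=> mA; exists [set x | A ((l i)%:R * dotp theta x)]; last by rewrite setTI.
rewrite -[X in measurable X]setTI.
have : measurable_fun [set: 'rV[R]_d] (fun x => (l i)%:R * dotp theta x).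
  apply: measurable_funM => //.
  by apply: continuous_row_measurable; exact: dotp_continuous.
by apply.
Qed.

(** An event about the coins and the choices is independent of the innovations;
    events about the latter are appended one by one. *)
Lemma event_product_indep_steps r s W : event_product s W ->
  all (later_choice 0) s -> indep_of_first P a r W.
Proof.
move=> epW /allP ls; split; first exact: event_product_bounded epW.
move=> A mA.
suff [s' [epr sr Er]] : exists s', [/\
    event_product s' (fun w => W w * \prod_(i < r) \1_(A i) (a i w)),
    (forall i, inl (inl i.+1) \in s' -> (i < r)%N) &
    mean (fun w => W w * \prod_(i < r) \1_(A i) (a i w)) =
    mean W * \prod_(i < r) mean (fun w => \1_(A i) (a i w))] by [].
elim: r => [|r [s' [epr sr Er]]].
  have E : (fun w => W w * \prod_(i < 0) \1_(A i) (a i w)) = W.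
    by apply/funext => w; rewrite big_ord0 mulr1.
  exists s; split; rewrite ?E ?big_ord0 ?mulr1 //.
  by move=> i /ls.
have fresh : inl (inl r.+1) \notin s' by apply/negP => /sr; rewrite ltnn.
have E : (fun w => W w * \prod_(i < r.+1) \1_(A i) (a i w)) =
    (fun w => \1_(a r @^-1` A r) w * (W w * \prod_(i < r) \1_(A i) (a i w))).
  apply/funext => w; rewrite big_ord_recr /= mulrA mulrC; congr (_ * _).
exists (inl (inl r.+1) :: s'); rewrite E; split.
- by apply: EventCons => //; exact: step_event.
- by move=> i; rewrite inE => /predU1P[[->]//|/sr/ltnW].
- rewrite (mean_event_product hswim fresh isT (step_event r (mA r)) epr) Er.
  by rewrite big_ord_recr /= mulrC mulrA.
Qed.

Lemma mean_trig_steps s W : event_product s W -> all (later_choice 0) s ->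
  mean (fun w => W w * cos (\sum_(i < m) a i w)) =
    mean W * expR (- \sum_(i < m) ((l i)%:R * enorm theta) `^ alpha) /\
  mean (fun w => W w * sin (\sum_(i < m) a i w)) = 0.
Proof.
move=> epW ls; have iW := event_product_indep_steps m epW ls.
have [|-> ->] := mean_trig_sum ma iW.
  by move=> i _; exact: (mean_trig_step theta _ (ltn0Sn i)).2.
split=> //; congr (_ * _).
rewrite -sumrN expR_sum; apply: eq_bigr => i _.
by rewrite (mean_trig_step theta (l i)%:R (ltn0Sn i)).1 ger0_norm.
Qed.

End Base.

(** A label that does not occur contributes f 0 = 0. *)
Lemma sum_count_labels (f : nat -> R) n r : f 0%N = 0 -> labelling n r ->
  \sum_(j < n.+1) f (count_mem j.+1 r) = cluster_sum f r.
Proof.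
move=> f0 /andP[_ /allP rn]; rewrite /cluster_sum.
rewrite -(big_mkord xpredT (fun j => f (count_mem j.+1 r))).
rewrite -(big_add1 _ _ 0 n.+2 xpredT (fun j => f (count_mem j r))) /=.
rewrite (bigID (fun j => j \in r)) /= [X in _ + X]big1 ?addr0; last first.
  by move=> j /count_memPn ->.
rewrite -big_filter; apply: perm_big; apply: uniq_perm.
- by rewrite filter_uniq // iota_uniq.
- exact: undup_uniq.
move=> j; rewrite mem_filter mem_undup mem_index_iota.
by case: (boolP (j \in r)) => //= /rn; rewrite ltnS.
Qed.

Lemma step_weight_count r j : step_weight (fun=> 0%N) (fun=> 1%N) r j = count_mem j.+1 r.
Proof.
rewrite /step_weight add0n; apply/eqP; rewrite -(eqr_nat R) natr_sum -sum1_count natr_sum.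
rewrite [X in _ == X]big_mkcond /= (eq_bigr (fun x => (x == j.+1)%:R)); last first.
  by move=> x _; case: eqP.
by rewrite sum_label; apply/eqP; apply: eq_bigr => i _; rewrite muln1.
Qed.

(** Instance of [swim_mean_recursion] with all the steps having coefficient 1 and
    no innovation added: the weights are then the cluster sizes. *)
Lemma swim_charfun (theta : 'rV[R]_d) n :
  mean (fun w => cos (dotp theta (swim_position Y n.+1 w))) =
    swim_mean p n (fun r => expR (- (enorm theta `^ alpha *
                                     cluster_sum (fun k => k%:R `^ alpha) r))) /\
  mean (fun w => sin (dotp theta (swim_position Y n.+1 w))) = 0.
Proof.
have mc := @cos_measurable R; have ms := @sin_measurable R.
have cM : exists M : R, forall x, `|cos x| <= M by exists 1; exact: cos_max.
have sM : exists M : R, forall x, `|sin x| <= M by exists 1; exact: sin_max.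
have E (g : R -> R) : (fun w => g (dotp theta (swim_position Y n.+1 w))) =
    (fun w => 1 * g (\sum_(i < n.+1) 1%:R * dotp theta (Y i.+1 w)
       + \sum_(i < n.+1) 0%:R * dotp theta (xi i.+1 w))).
  apply/funext => w; rewrite mul1r [X in _ + X]big1 ?addr0; last by move=> i _; rewrite mul0r.
  congr g; rewrite /swim_position big_add1 /= big_mkord.
  elim/big_rec2: _ => [|i u v _ <-]; first by rewrite dotp0r.
  by rewrite dotpDr mul1r.
have nil := EventNil xi coin U.
have Rc := swim_mean_recursion p01 hswim mc cM
   (kappa := fun l => expR (- \sum_(i < n.+1) ((l i)%:R * enorm theta) `^ alpha))
   (fun s W l h1 h2 => (mean_trig_steps n.+1 theta l h1 h2).1) (ltnSn n).
have Rs := swim_mean_recursion p01 hswim ms sM (kappa := fun=> 0)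
   (fun s W l h1 h2 => etrans (mean_trig_steps n.+1 theta l h1 h2).2 (esym (mulr0 _))) (ltnSn n).
split.
  rewrite E (Rc (fun=> 1%N) (fun=> 0%N) _ _ nil isT) mean_cst mul1r.
  apply: eq_swim_mean => // r lr; congr (expR (- _)).
  rewrite -(sum_count_labels _ lr) ?powR0 ?lt0r_neq0 // big_distrr /=.
  apply: eq_bigr => i _; rewrite step_weight_count mulrC powRM ?sqrtr_ge0 //.
by rewrite E (Rs (fun=> 1%N) (fun=> 0%N) _ _ nil isT) mean_cst mul1r swim_mean_cst.
Qed.

End SwimCharacteristic.

(** * Bernstein operators in several variables *)

Section BernsteinWalk.
Context (R : realType) (d : nat).
Implicit Types (v : 'I_d -> R) (f g : ('I_d -> nat) -> R) (s : seq 'I_d).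

Definition bump_at (i : 'I_d) (k : 'I_d -> nat) : 'I_d -> nat :=
  fun j => (k j + (j == i))%N.

(** The mean of f at the final counts of successive independent coin flips, the
    flip at i in s succeeding with probability v i.  With each i repeated N times
    this is the Bernstein operator of degree N in each variable; the recursion
    avoids binomial coefficients. *)
Fixpoint bernstein_walk s v f : R :=
  if s is i :: s' then
    v i * bernstein_walk s' v (fun k => f (bump_at i k))
    + (1 - v i) * bernstein_walk s' v f
  else f (fun=> 0%N).

Lemma bernstein_walkD s v f g :
  bernstein_walk s v (fun k => f k + g k) = bernstein_walk s v f + bernstein_walk s v g.
Proof. by elim: s f g => [//|i s IH] f g /=; rewrite !IH; ring. Qed.

Lemma bernstein_walkZ s v c f :
  bernstein_walk s v (fun k => c * f k) = c * bernstein_walk s v f.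
Proof. by elim: s f => [//|i s IH] f /=; rewrite !IH; ring. Qed.

Lemma bernstein_walk_cst s v c : bernstein_walk s v (fun=> c) = c.
Proof. by elim: s => [//|i s IH] /=; rewrite !IH; ring. Qed.

Lemma bernstein_walk_sum s v (I : Type) (r : seq I) (F : I -> ('I_d -> nat) -> R) :
  bernstein_walk s v (fun k => \sum_(j <- r) F j k) = \sum_(j <- r) bernstein_walk s v (F j).
Proof.
elim: r => [|j r IH].
  by under eq_fun do rewrite big_nil; rewrite big_nil bernstein_walk_cst.
by under eq_fun do rewrite big_cons; rewrite big_cons bernstein_walkD IH.
Qed.

Lemma ler_bernstein_walk s v f g : (forall i, 0 <= v i <= 1) ->
  (forall k, f k <= g k) -> bernstein_walk s v f <= bernstein_walk s v g.
Proof.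
move=> v01; elim: s f g => [|i s IH] f g fg /=; first exact: fg.
have /andP[v0 v1] := v01 i.
by apply: lerD; apply: ler_wpM2l; rewrite ?subr_ge0 //; apply: IH => k; exact: fg.
Qed.

Lemma bernstein_walk_norm s v f : (forall i, 0 <= v i <= 1) ->
  `|bernstein_walk s v f| <= bernstein_walk s v (fun k => `|f k|).
Proof.
move=> v01; rewrite ler_norml; apply/andP; split.
  rewrite -mulN1r -bernstein_walkZ; apply: ler_bernstein_walk => // k.
  by rewrite mulN1r lerNl -normrN ler_norm.
by apply: ler_bernstein_walk => // k; exact: ler_norm.
Qed.

(** The count at j is binomial.  Its variance is found without its mean, because
    the cross terms of one flip cancel. *)
Lemma bernstein_walk_var s v j :
  bernstein_walk s v (fun k => ((k j)%:R - (count_mem j s)%:R * v j) ^+ 2) =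
  (count_mem j s)%:R * (v j * (1 - v j)).
Proof.
elim: s => [|i s IH] /=; first by rewrite mul0r subrr expr0n /= mul0r.
pose S a := bernstein_walk s v (fun k => ((k j)%:R - (count_mem j s)%:R * v j + a) ^+ 2).
have ES a : S a = (count_mem j s)%:R * (v j * (1 - v j))
    + 2 * a * bernstein_walk s v (fun k => (k j)%:R - (count_mem j s)%:R * v j) + a ^+ 2.
  rewrite -IH -bernstein_walkZ -bernstein_walkD -(bernstein_walk_cst s v (a ^+ 2)).
  by rewrite -bernstein_walkD; congr bernstein_walk; apply/funext => k; ring.
case: (eqVneq i j) => [->|ij].
  transitivity (v j * S (1 - v j) + (1 - v j) * S (- v j)).
    congr (_ * _ + _ * _); congr bernstein_walk; apply/funext => k.
      by rewrite /bump_at eqxx !natrD mulr1n; congr (_ ^+ 2); ring.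
    by rewrite natrD mulr1n; congr (_ ^+ 2); ring.
  by rewrite !ES natrD mulr1n; ring.
rewrite add0n -[RHS]IH.
have -> : (fun k => ((bump_at i k j)%:R - (count_mem j s)%:R * v j) ^+ 2) =
   (fun k => ((k j)%:R - (count_mem j s)%:R * v j) ^+ 2).
  by apply/funext => k; rewrite /bump_at eq_sym (negbTE ij) addn0.
by ring.
Qed.

Definition walk_schedule (N : nat) : seq 'I_d := flatten (nseq N (enum 'I_d)).

Lemma count_walk_schedule N j : count_mem j (walk_schedule N) = N.
Proof.
rewrite /walk_schedule count_flatten map_nseq sumn_nseq.
by rewrite (count_uniq_mem _ (enum_uniq _)) mem_enum mul1n.
Qed.

(** Bernstein's proof of the Weierstrass theorem: a function that is within e plus
    a multiple of the squared distance is averaged, and the variance is at most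
    1 / N in each variable. *)
Lemma bernstein_approx (h : ('I_d -> nat) -> R) (N : nat) v (y e C : R) : (0 < N)%N ->
  0 <= C -> (forall i, 0 <= v i <= 1) ->
  (forall k, `|y - h k| <= e + C * \sum_j ((k j)%:R / N%:R - v j) ^+ 2) ->
  `|y - bernstein_walk (walk_schedule N) v h| <= e + C * d%:R / N%:R.
Proof.
move=> N0 C0 v01 H.
have NR : 0 < N%:R :> R by rewrite ltr0n.
have -> : y - bernstein_walk (walk_schedule N) v h =
    bernstein_walk (walk_schedule N) v (fun k => y - h k).
  rewrite -[y in LHS](bernstein_walk_cst (walk_schedule N) v) -mulN1r -bernstein_walkZ.
  by rewrite -bernstein_walkD; congr bernstein_walk; apply/funext => k; ring.
apply: le_trans (bernstein_walk_norm _ _ v01) _.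
apply: le_trans (ler_bernstein_walk _ v01 H) _.
rewrite bernstein_walkD bernstein_walk_cst bernstein_walkZ lerD2l -mulrA ler_wpM2l //.
rewrite bernstein_walk_sum.
apply: (@le_trans _ _ (\sum_(j < d) N%:R^-1)); last first.
  by rewrite big_const_ord iter_addr_0 mulr_natl.
apply: ler_sum => j _.
have := bernstein_walk_var (walk_schedule N) v j; rewrite count_walk_schedule => V.
rewrite (_ : (fun k => _) = (fun k => N%:R^-2 * ((k j)%:R - N%:R * v j) ^+ 2)); last first.
  by apply/funext => k; field; exact: lt0r_neq0.
rewrite bernstein_walkZ V.
have /andP[v0 v1] := v01 j.
rewrite (_ : N%:R^-2 * _ = N%:R^-1 * (v j * (1 - v j))); last first.
  by field; exact: lt0r_neq0.
rewrite ler_piMr ?invr_ge0 ?(ltW NR) // mulr_ile1 ?subr_ge0 //.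
by rewrite gerBl.
Qed.

End BernsteinWalk.

(** * Approximation by trigonometric polynomials *)

Section TrigPolynomials.
Context (R : realType) (d : nat).
Implicit Types (f g : 'rV[R]_d -> R).

Inductive trig_poly : ('rV[R]_d -> R) -> Prop :=
| TrigCos theta : trig_poly (fun x => cos (dotp theta x))
| TrigSin theta : trig_poly (fun x => sin (dotp theta x))
| TrigAdd f g : trig_poly f -> trig_poly g -> trig_poly (fun x => f x + g x)
| TrigScale c f : trig_poly f -> trig_poly (fun x => c * f x).

Lemma trig_poly_cst c : trig_poly (fun=> c).
Proof.
have -> : (fun=> c) = (fun x => c * cos (dotp (0 : 'rV[R]_d) x)).
  apply/funext => x; rewrite /dotp big1 ?cos0 ?mulr1 // => i _.
  by rewrite mxE mul0r.
by apply: TrigScale; exact: TrigCos.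
Qed.

Lemma dotpDl (a b x : 'rV[R]_d) : dotp (a + b) x = dotp a x + dotp b x.
Proof.
by rewrite /dotp -big_split /=; apply: eq_bigr => i _; rewrite mxE mulrDl.
Qed.

Lemma dotpNl (a x : 'rV[R]_d) : dotp (- a) x = - dotp a x.
Proof. by rewrite -scaleN1r dotpZl mulN1r. Qed.

(** The product formulas of trigonometry. *)
Lemma trig_polyM f g : trig_poly f -> trig_poly g -> trig_poly (fun x => f x * g x).
Proof.
have half (F G : 'rV[R]_d -> R) : trig_poly F -> trig_poly G ->
    trig_poly (fun x => 2^-1 * (F x + G x)) by move=> tF tG; apply/TrigScale/TrigAdd.
have halfB (F G : 'rV[R]_d -> R) : trig_poly F -> trig_poly G ->
    trig_poly (fun x => 2^-1 * (F x + -1 * G x)).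
  by move=> tF tG; apply/TrigScale/TrigAdd => //; apply: TrigScale.
elim=> [a|a|F G _ IF _ IG tg|c F _ IF tg].
- elim=> [b|b|F G _ IF _ IG|c F _ IF].
  + rewrite (_ : (fun x => _) = (fun x => 2^-1 * (cos (dotp (a + b) x) + cos (dotp (a - b) x)))).
      by apply: half; exact: TrigCos.
    by apply/funext => x; rewrite !dotpDl !dotpNl !cosD !cosN !sinN; field.
  + rewrite (_ : (fun x => _) = (fun x => 2^-1 * (sin (dotp (a + b) x) + -1 * sin (dotp (a - b) x)))).
      by apply: halfB; exact: TrigSin.
    by apply/funext => x; rewrite !dotpDl !dotpNl !sinD !cosN !sinN; field.
  + rewrite (_ : (fun x => _) = (fun x => cos (dotp a x) * F x + cos (dotp a x) * G x)).
      exact: TrigAdd.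
    by apply/funext => x; rewrite mulrDr.
  + rewrite (_ : (fun x => _) = (fun x => c * (cos (dotp a x) * F x))).
      exact: TrigScale.
    by apply/funext => x; rewrite mulrCA.
- elim=> [b|b|F G _ IF _ IG|c F _ IF].
  + rewrite (_ : (fun x => _) = (fun x => 2^-1 * (sin (dotp (a + b) x) + sin (dotp (a - b) x)))).
      by apply: half; exact: TrigSin.
    by apply/funext => x; rewrite !dotpDl !dotpNl !sinD !cosN !sinN; field.
  + rewrite (_ : (fun x => _) = (fun x => 2^-1 * (cos (dotp (a - b) x) + -1 * cos (dotp (a + b) x)))).
      by apply: halfB; exact: TrigCos.
    by apply/funext => x; rewrite !dotpDl !dotpNl !cosD !cosN !sinN; field.
  + rewrite (_ : (fun x => _) = (fun x => sin (dotp a x) * F x + sin (dotp a x) * G x)).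
      exact: TrigAdd.
    by apply/funext => x; rewrite mulrDr.
  + rewrite (_ : (fun x => _) = (fun x => c * (sin (dotp a x) * F x))).
      exact: TrigScale.
    by apply/funext => x; rewrite mulrCA.
- rewrite (_ : (fun x => _) = (fun x => F x * g x + G x * g x)).
    by apply: TrigAdd; [exact: IF|exact: IG].
  by apply/funext => x; rewrite mulrDl.
- rewrite (_ : (fun x => _) = (fun x => c * (F x * g x))).
    by apply: TrigScale; exact: IF.
  by apply/funext => x; rewrite mulrA.
Qed.

Lemma trig_poly_walk s (v : 'I_d -> 'rV[R]_d -> R) h :
  (forall i, trig_poly (v i)) ->
  trig_poly (fun x => bernstein_walk s (fun i => v i x) h).
Proof.
move=> tv; elim: s h => [|i s IH] h /=; first exact: trig_poly_cst.
apply: TrigAdd; apply: trig_polyM => //.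
rewrite (_ : (fun x => _) = (fun x => 1 + -1 * v i x)); last first.
  by apply/funext => x; rewrite mulN1r.
by apply: TrigAdd; [exact: trig_poly_cst|exact: TrigScale].
Qed.

Lemma dotp_delta (i : 'I_d) (x : 'rV[R]_d) : dotp (delta_mx ord0 i) x = x ord0 i.
Proof.
rewrite /dotp (bigD1 i) //= big1 ?addr0; first by rewrite mxE !eqxx mul1r.
by move=> j /negbTE ji; rewrite mxE ji andbF mul0r.
Qed.

(** From sin z - sin y = 2 cos((z + y) / 2) sin((z - y) / 2), where both half
    angles stay in a compact part of the open interval of half-length pi / 2,
    because y does. *)
Lemma sin_separates (e : R) : 0 < e -> exists2 c : R, 0 < c &
  forall y z : R, `|y| <= 2^-1 -> - (pi / 2) <= z <= pi / 2 -> e <= `|z - y| ->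
  c <= `|sin z - sin y|.
Proof.
move=> e0; pose K : R := (2^-1 + pi / 2) / 2.
have pi2 : 1 <= pi / 2 :> R := pihalf_ge1 R.
have K0 : 0 <= K by rewrite /K; lra.
have Kpi : K < pi / 2 by rewrite /K; lra.
have cK : 0 < cos K by apply: cos_gt0_pihalf; apply/andP; split => //; lra.
pose e' := Num.min (e / 2) K.
have e'0 : 0 < e' by rewrite lt_min divr_gt0 //= /K; lra.
have e'pi : e' < pi / 2 by rewrite gt_min Kpi orbT.
have sK : 0 < sin e' by apply: sin_gt0_pihalf; rewrite e'0.
exists (2 * cos K * sin e') => [|y z]; first by rewrite !mulr_gt0.
rewrite ler_norml => /andP[y0 y1] /andP[z0 z1] ezy.
pose a := (z + y) / 2; pose b := (z - y) / 2.
have -> : sin z - sin y = 2 * (cos a * sin b).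
  rewrite (_ : z = a + b); last by rewrite /a /b; field.
  rewrite (_ : y = a - b); last by rewrite /a /b; field.
  by rewrite sinD sinB; ring.
have aK : `|a| <= K by rewrite ler_norml /a /K; apply/andP; split; lra.
have bK : `|b| <= K by rewrite ler_norml /b /K; apply/andP; split; lra.
have be : e' <= `|b|.
  have -> : `|b| = `|z - y| / 2 by rewrite normrM normfV (ger0_norm (ler0n _ 2)).
  by rewrite ge_min ler_pM2r ?invr_gt0 // ezy.
rewrite !normrM ger0_norm // -mulrA ler_pM2l //; apply: ler_pM => //.
- exact: ltW.
- exact: ltW.
- apply: le_trans (ler_norm _); rewrite -(cos_norm a) leNgt; apply/negP.
  have Kin : K \in `[0, pi]%R by rewrite in_itv /= K0; lra.
  have ain : `|a| \in `[0, pi]%R by rewrite in_itv /= normr_ge0 (le_trans aK) //; lra.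
  by rewrite ltr_cos // ltNge aK.
- have -> : `|sin b| = `|sin `|b| |.
    by case: (ger0P b) => // _; rewrite sinN normrN.
  apply: le_trans (ler_norm _); rewrite leNgt; apply/negP.
  have bin : `|b| \in `[- (pi / 2), pi / 2]%R.
    by rewrite in_itv /= (le_trans _ (normr_ge0 b)) ?(le_trans bK) //; lra.
  have ein : e' \in `[- (pi / 2), pi / 2]%R.
    by rewrite in_itv /= ?(le_trans _ (ltW e'0)) ?(ltW e'pi) //; lra.
  by rewrite ltr_sin // ltNge be.
Qed.

End TrigPolynomials.

Section TrigApproximation.
Context (R : realType) (d : nat).

(** Heine's theorem, by compactness of the box. *)
Lemma uniformly_continuous_on_box (f : 'rV[R]_d -> R) (B e : R) :
  continuous f -> 0 < e -> exists2 del : R, 0 < del &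
  forall x z : 'rV[R]_d, (forall i, `|x ord0 i| <= B) -> (forall i, `|z ord0 i| <= B) ->
    (forall i, `|z ord0 i - x ord0 i| < del) -> `|f x - f z| <= e.
Proof.
move=> cf e0; pose K : set 'rV[R]_d := [set x | forall i, `[- B, B]%classic (x ord0 i)].
have cK : compact K.
  by apply: (@rV_compact R d (fun=> `[- B, B]%classic)) => i; exact: segment_compact.
have Kbox (x : 'rV[R]_d) : (forall i, `|x ord0 i| <= B) -> K x.
  by move=> xB i; rewrite /= in_itv /= -ler_norml.
pose Pr (del : R) (x : 'rV[R]_d) := forall z : 'rV[R]_d,
  (forall i, `|z ord0 i - x ord0 i| < del) -> `|f x - f z| <= e.
have near_del : \forall del \near 0^'+, K `<=` Pr del.
  apply: (compact_near_coveringP K).1 => // x Kx.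
  have e20 : 0 < e / 2 by rewrite divr_gt0.
  have /cvgrPdist_lt/(_ _ e20) /nbhs_ballP[r r0 hr] := cf x.
  have r20 : 0 < r / 2 by rewrite divr_gt0.
  exists (ball x (r / 2), [set del | del < r / 2]).
    split; first exact: nbhsx_ballx.
    by apply: nbhs_right_lt.
  move=> [y del] /= [[_ xy] delr] z zy.
  have h1 : `|f x - f y| < e / 2.
    apply: hr; split => // i j; rewrite ord1; apply: le_ball (xy ord0 j).
    by rewrite ler_pdivrMr // ler_peMr ?(ltW r0) ?ler1n.
  have h2 : `|f x - f z| < e / 2.
    apply: hr; split => // i j; rewrite ord1 /ball /=.
    have := xy ord0 j; rewrite /ball /= => xyj.
    rewrite -(subrKA (y ord0 j)); apply: le_lt_trans (ler_normD _ _) _.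
    have := zy j; rewrite distrC; lra.
  rewrite -(subrKA (f x)); apply: le_trans (ler_normD _ _) _.
  by rewrite distrC; lra.
near (0 : R)^'+ => del.
have hdel : K `<=` Pr del by near: del.
exists del; first by near: del; exact: nbhs_right_gt.
by move=> x z /Kbox Kx _; exact: hdel.
Unshelve. all: by end_near. Qed.

(** The Bernstein operator is applied in the variables (1 + sin(x_i / c)) / 2,
    which are trigonometric polynomials in [0, 1] for every x, so that the bound M
    is preserved everywhere; the choice c = 2 L makes them separate the points of
    the box. *)
Lemma trig_approx (f : 'rV[R]_d -> R) (M L e : R) : continuous f ->
  (forall x, `|f x| <= M) -> 0 < L -> 0 < e ->
  exists g, [/\ trig_poly g, forall x, `|g x| <= M &
    forall x : 'rV[R]_d, (forall i, `|x ord0 i| <= L) -> `|f x - g x| <= e].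
Proof.
move=> cf fM L0 e0; pose c := 2 * L.
have c0 : 0 < c by rewrite mulr_gt0.
have M0 : 0 <= M := le_trans (normr_ge0 _) (fM 0).
have pi0 : 1 <= pi / 2 :> R := pihalf_ge1 R.
have e20 : 0 < e / 2 by rewrite divr_gt0.
have [del del0 hdel] := uniformly_continuous_on_box (c * (pi / 2)) cf e20.
have [eta eta0 heta] := sin_separates (divr_gt0 del0 c0).
have [C CE] : exists C, C = 8 * M / eta ^+ 2 by exists (8 * M / eta ^+ 2).
have C0 : 0 <= C by rewrite CE; apply: divr_ge0; [exact: mulr_ge0|exact: sqr_ge0].
have x0 : 0 <= 2 * C * d%:R / e by rewrite divr_ge0 ?(ltW e0) // !mulr_ge0.
pose N := (Num.bound (2 * C * d%:R / e)).+1.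
have NR : 0 < N%:R :> R by rewrite ltr0n.
have hN : C * d%:R / N%:R <= e / 2.
  have := archi_boundP x0; rewrite ltr_pdivrMr // => h.
  have bN : (Num.bound (2 * C * d%:R / e))%:R <= N%:R :> R by rewrite ler_nat.
  have := ler_wpM2r (ltW e0) bN; move: h; rewrite ler_pdivrMr //.
  by move: (_%:R * e) => u; lra.
(* Counts above N have no node, so they are capped: since v <= 1, capping only
   decreases the distance to v. *)
pose kap (k : 'I_d -> nat) j : R := (minn (k j) N)%:R / N%:R.
pose node k : 'rV[R]_d := \row_j (c * asin (2 * kap k j - 1)).
pose v (i : 'I_d) (x : 'rV[R]_d) : R :=
  2^-1 * (1 + sin (dotp (c^-1 *: delta_mx ord0 i) x)).
have vE i x : v i x = 2^-1 * (1 + sin (x ord0 i / c)).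
  by rewrite /v dotpZl dotp_delta mulrC [_ / c]mulrC mulrC.
have v01 x i : 0 <= v i x <= 1.
  have := sin_geN1 (x ord0 i / c); have := sin_le1 (x ord0 i / c); rewrite vE.
  by move: (sin _) => u ? ?; apply/andP; split; lra.
have kap01 k j : 0 <= kap k j <= 1.
  by rewrite divr_ge0 //= ler_pdivrMr // mul1r ler_nat geq_minr.
have arg_in k j : -1 <= 2 * kap k j - 1 <= 1.
  by have /andP[? ?] := kap01 k j; apply/andP; split; lra.
exists (fun x => bernstein_walk (walk_schedule d N) (fun i => v i x) (fun k => f (node k))).
split.
- apply: trig_poly_walk => i; apply: TrigScale; apply: TrigAdd; first exact: trig_poly_cst.
  exact: TrigSin.
- move=> x; apply: le_trans (bernstein_walk_norm _ _ (v01 x)) _.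
  rewrite -[leRHS](bernstein_walk_cst (walk_schedule d N) (fun i => v i x)).
  by apply: ler_bernstein_walk.
move=> x xL; apply: (@le_trans _ _ (e / 2 + C * d%:R / N%:R)); last by move: hN; lra.
apply: bernstein_approx => // k.
have S0 : 0 <= \sum_j ((k j)%:R / N%:R - v j x) ^+ 2.
  by apply: sumr_ge0 => j _; exact: sqr_ge0.
case: (pselect (forall i, `|node k ord0 i - x ord0 i| < del)) => [close|].
  rewrite ler_wpDr ?mulr_ge0 //; apply: hdel => // i.
    by apply: le_trans (xL i) _; rewrite /c -mulrA mulrCA ler_peMr ?ltW //; lra.
  rewrite mxE normrM (gtr0_norm c0) ler_pM2l // ler_norml.
  by rewrite asin_geNpi2 ?asin_lepi2 // arg_in.
move=> /existsNP[j /negP]; rewrite -leNgt => far.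
have sep : eta <= 2 * `|kap k j - v j x|.
  have -> : 2 * `|kap k j - v j x| = `|sin (node k ord0 j / c) - sin (x ord0 j / c)|.
    rewrite mxE [c * _]mulrC mulfK ?lt0r_neq0 // asinK ?in_itv //=.
    by rewrite -[2 in LHS]ger0_norm // -normrM vE; congr (`| _ |); field.
  apply: heta.
  - rewrite normrM normfV (gtr0_norm c0) ler_pdivrMr // /c mulrA mulVf // mul1r.
    exact: xL.
  - rewrite mxE [c * _]mulrC mulfK ?lt0r_neq0 //.
    by rewrite asin_geNpi2 ?asin_lepi2 // arg_in.
  - by rewrite -mulrBl normrM normfV (gtr0_norm c0) ler_pM2r ?invr_gt0.
have kapk : (kap k j - v j x) ^+ 2 <= ((k j)%:R / N%:R - v j x) ^+ 2.
  rewrite /kap; case: (boolP (k j <= N)%N) => [/minn_idPl -> //|]; rewrite -ltnNge => Nk.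
  rewrite (minn_idPr (ltnW Nk)) divff ?lt0r_neq0 //.
  have /andP[vj0 vj1] := v01 x j.
  have k1 : 1 <= (k j)%:R / N%:R :> R by rewrite ler_pdivlMr // mul1r ler_nat ltnW.
  rewrite ler_sqr ?nnegrE; [|by rewrite subr_ge0|by rewrite subr_ge0 (le_trans vj1)].
  by rewrite lerD2r.
have sepS : eta ^+ 2 <= 4 * \sum_j ((k j)%:R / N%:R - v j x) ^+ 2.
  apply: (@le_trans _ _ (4 * (kap k j - v j x) ^+ 2)).
    rewrite -[X in _ <= 4 * X]real_normK ?num_real //.
    have -> : 4 * `|kap k j - v j x| ^+ 2 = (2 * `|kap k j - v j x|) ^+ 2 by ring.
    by rewrite ler_sqr ?nnegrE ?(ltW eta0) // mulr_ge0.
  rewrite ler_pM2l // (le_trans kapk) // (bigD1 j) //= lerDl.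
  by apply: sumr_ge0 => i _; exact: sqr_ge0.
apply: (@le_trans _ _ (2 * M)).
  by apply: le_trans (ler_normB _ _) _; have := fM x; have := fM (node k); lra.
rewrite ler_wpDl ?(ltW e20) // CE.
rewrite [leRHS](_ : _ = 2 * M * (4 * (\sum_j ((k j)%:R / N%:R - v j x) ^+ 2) / eta ^+ 2)).
  by rewrite ler_peMr ?mulr_ge0 // ler_pdivlMr ?exprn_gt0 // mul1r.
by field; exact: lt0r_neq0.
Qed.

End TrigApproximation.

(** * Tightness *)

Section Tightness.
Context (R : realType).

Definition tail (L y : R) : R := (L <= `|y|)%R%:R.

Lemma tailE L : tail L = \1_[set y | L <= `|y|].
Proof.
apply/funext => y; rewrite /tail indicE; congr (nat_of_bool _)%:R.
by apply/idP/idP; rewrite inE.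
Qed.

Lemma tail_measurable_set L : measurable [set y : R | L <= `|y|].
Proof.
have -> : [set y : R | L <= `|y|] = Num.Def.normr @^-1` `[L, +oo[.
  by apply/seteqP; split => y /=; rewrite in_itv /= andbT.
by rewrite -[X in measurable X]setTI; exact: normr_measurable.
Qed.

Lemma ler_tail L L' y : L <= L' -> tail L' y <= tail L y.
Proof.
move=> LL; rewrite /tail ler_nat; case: (leP L' `|y|) => //= Ly.
by rewrite (le_trans LL Ly).
Qed.

Lemma tail_ge0 L y : 0 <= tail L y.
Proof. by []. Qed.

Context (disp : measure_display) (T : measurableType disp) (P : probability T R).

Lemma bounded_rv_tail L (Z : T -> R) : measurable_fun [set: T] Z ->
  bounded_rv (fun w => tail L (Z w)).
Proof.
move=> mZ; apply: bounded_rv_comp => //.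
  by rewrite tailE; exact: measurable_indic (tail_measurable_set L).
by exists 1 => y; rewrite /tail normr_nat lern1 leq_b1.
Qed.

Lemma tail_small (Z : T -> R) (e : R) : measurable_fun [set: T] Z -> 0 < e ->
  exists n : nat, mean P (fun w => tail n%:R (Z w)) <= e.
Proof.
move=> mZ e0; pose A (n : nat) := Z @^-1` [set y : R | n%:R <= `|y|].
have mA n : measurable (A n).
  by rewrite -[X in measurable X]setTI; apply: mZ => //; exact: tail_measurable_set.
have PA n : P (A n) = (mean P (fun w => tail n%:R (Z w)))%:E.
  rewrite -[LHS]fineK ?fin_num_measure // -mean_indic //; congr (mean P _)%:E.
  by apply/funext => w; rewrite tailE !indicE; congr (nat_of_bool _)%:R; apply/idP/idP; rewrite !inE.
have : P (A n) @[n --> \oo] --> P (\bigcap_n A n).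
  apply: nonincreasing_cvg_mu => //.
  - by rewrite (le_lt_trans (probability_le1 P (mA 0%N))) // ltry.
  - exact: bigcapT_measurable.
  - apply/nonincreasing_seqP => n; apply/subsetPset => w /=.
    by apply: le_trans; rewrite ler_nat.
have -> : \bigcap_n A n = set0.
  apply/seteqP; split => // w /= H.
  have := H (Num.bound `|Z w|) I; rewrite /A /=.
  by rewrite leNgt archi_boundP.
rewrite measure0 => /fine_cvgP[_ /cvgrPdist_lt/(_ _ e0) [N _ /(_ N (leqnn N))]].
rewrite /= PA /= sub0r normrN => h; exists N; apply: ltW.
exact: le_lt_trans (ler_norm _) h.
Qed.

(** Between shell k and shell k.+1, the angle y / 2^k is in [pi / 2, pi], where
   the cosine is nonpositive. *)
Let shell (k : nat) : R := 2 ^+ k * (pi / 2).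

Lemma tail_shell k y :
  tail (shell k) y <= 1 - cos (2^-1 ^+ k * y) + tail (shell k.+1) y.
Proof.
have c0 : 0 <= 1 - cos (2^-1 ^+ k * y) by rewrite subr_ge0 cos_le1.
rewrite {1}/tail; case: (leP (shell k) `|y|) => /= ky; last by rewrite addr_ge0.
rewrite /tail; case: (leP (shell k.+1) `|y|) => /= yk; first by rewrite lerDr.
rewrite addr0 lerBrDr gerDl leNgt; apply/negP.
have k0 : 0 < 2 ^+ k :> R by rewrite exprn_gt0.
have E : `|2^-1 ^+ k * y| = `|y| / 2 ^+ k.
  by rewrite normrM exprVn normfV (gtr0_norm k0) mulrC.
have in1 : pi / 2 <= `|2^-1 ^+ k * y| by rewrite E ler_pdivlMr // mulrC.
have in2 : `|2^-1 ^+ k * y| <= pi.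
  rewrite E ler_pdivrMr //; apply: ltW; apply: (lt_le_trans yk).
  by rewrite /shell exprS le_eqVlt; apply/orP; left; apply/eqP; field.
have hin1 : (pi : R) / 2 \in `[0, pi]%R.
  by rewrite in_itv /= divr_ge0 ?pi_ge0 //= ler_pdivrMr // ler_peMr ?pi_ge0 // ler1n.
have hin2 : `|2^-1 ^+ k * y| \in `[0, pi]%R by rewrite in_itv /= normr_ge0.
by rewrite -cos_norm -[X in X < _](@cos_pihalf R) ltr_cos // ltNge in1.
Qed.

Lemma tail_shells K m y : tail (shell K) y <=
  \sum_(i < m) (1 - cos (2^-1 ^+ (K + i) * y)) + tail (shell (K + m)) y.
Proof.
elim: m => [|m IH]; first by rewrite big_ord0 add0r addn0.
rewrite big_ord_recr /= -addrA addnS; apply: le_trans IH _.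
by rewrite lerD2l; exact: tail_shell.
Qed.

Lemma sum_geometric_le (q : R) K m : 0 <= q < 1 ->
  \sum_(i < m) q ^+ (K + i) <= q ^+ K / (1 - q).
Proof.
move=> /andP[q0 q1]; have d0 : 0 < 1 - q by rewrite subr_gt0.
rewrite ler_pdivlMr //.
under eq_bigr do rewrite exprD.
rewrite -big_distrr /= -mulrA mulrC [_ * (1 - q)]mulrC -opprB mulNr -subrX1 opprB.
by rewrite ler_piMl ?exprn_ge0 // gerBl exprn_ge0.
Qed.

(** The k-th dyadic shell has mass at most C 2^(- a k), uniformly in n; the shells
    are summed up to one that depends on n, beyond which [tail_small] applies. *)
Lemma tight_of_cos (a C : R) (Z : nat -> T -> R) : 0 < a -> 0 <= C ->
  (forall n, measurable_fun [set: T] (Z n)) ->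
  (forall n (s : R), 0 < s <= 1 -> 1 - mean P (fun w => cos (s * Z n w)) <= C * s `^ a) ->
  forall e, 0 < e -> exists2 L, 0 <= L & forall n, mean P (fun w => tail L (Z n w)) <= e.
Proof.
move=> a0 C0 mZ H e e0; pose q : R := 2^-1 `^ a.
have q01 : 0 <= q < 1.
  rewrite powR_ge0 /=; have : 2^-1 `^ a < 1 `^ a :> R.
    by rewrite gt0_ltr_powR ?nnegrE // invf_lt1 // ltr1n.
  by rewrite powR1.
have d0 : 0 < 1 - q by rewrite subr_gt0; case/andP: q01.
have e20 : 0 < e / 2 by rewrite divr_gt0.
have [K hK] : exists K, C * (q ^+ K / (1 - q)) <= e / 2.
  have : q ^+ n @[n --> \oo] --> 0.
    by apply: cvg_expr; rewrite ger0_norm; case/andP: q01.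
  have x0 : 0 < e / 2 * (1 - q) / (C + 1) by rewrite divr_gt0 ?mulr_gt0 // ltr_wpDl.
  move=> /cvgrPdist_lt/(_ _ x0)[K _ /(_ K (leqnn K))] /=.
  rewrite sub0r normrN => h; exists K; have {h} := le_lt_trans (ler_norm _) h.
  rewrite ltr_pdivlMr ?ltr_wpDl // => h.
  rewrite mulrA ler_pdivrMr // mulrC; apply: le_trans (ltW h).
  by rewrite ler_wpM2l ?exprn_ge0 ?powR_ge0 // lerDl.
have pi20 : 0 <= pi / 2 :> R by rewrite divr_ge0 ?pi_ge0.
exists (shell K) => [|n]; first by rewrite mulr_ge0 ?exprn_ge0.
have [N hN] := tail_small (mZ n) e20.
have b1 (s : R) : bounded_rv (fun w => 1 - cos (s * Z n w)).
  apply: bounded_rvB; first exact: bounded_rv_cst.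
  apply: (@bounded_rv_comp _ _ _ (@cos R)).
  - by apply: continuous_measurable_fun; exact: continuous_cos.
  - by exists 1; exact: cos_max.
  - exact: measurable_funM.
have bS : bounded_rv (fun w => \sum_(i < N) (1 - cos (2^-1 ^+ (K + i) * Z n w))).
  by apply: bounded_rv_sum => i; exact: b1.
have bt L : bounded_rv (fun w => tail L (Z n w)) by exact: bounded_rv_tail.
apply: (@le_trans _ _ (mean P (fun w =>
    \sum_(i < N) (1 - cos (2^-1 ^+ (K + i) * Z n w)) + tail N%:R (Z n w)))).
  apply: ler_mean => // [|w]; first exact: bounded_rvD.
  apply: le_trans (tail_shells K N _) _; rewrite lerD2l; apply: ler_tail.
  rewrite /shell -[leLHS]mulr1; apply: ler_pM => //; last exact: pihalf_ge1.
  apply: (@le_trans _ _ (2 ^+ N)); first by rewrite -natrX ler_nat ltnW // ltn_expl.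
  by rewrite ler_weXn2l ?ler1n // leq_addl.
rewrite meanD // mean_sum; last by move=> i; exact: b1.
rewrite [leRHS](_ : e = e / 2 + e / 2); last by field.
apply: lerD => //; apply: le_trans hK.
apply: (@le_trans _ _ (\sum_(i < N) C * q ^+ (K + i))).
  apply: ler_sum => i _; rewrite meanB; last 2 first.
  - exact: bounded_rv_cst.
  - have := bounded_rvB (bounded_rv_cst T 1) (b1 (2^-1 ^+ (K + i))).
    by congr bounded_rv; apply/funext => w; ring.
  rewrite mean_cst; have -> : q ^+ (K + i) = (2^-1 ^+ (K + i)) `^ a.
    by rewrite -(powR_mulrn _ (powR_ge0 _ _)) powRAC powR_mulrn // invr_ge0.
  by apply: H; rewrite exprn_gt0 ?invr_gt0 //= exprn_ile1 // invf_le1 ?ler1n ?ltr0n.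
rewrite -mulr_sumr ler_wpM2l //; exact: sum_geometric_le.
Qed.

End Tightness.

(** * Characteristic functions and convergence in distribution *)

Section ContinuityTheorem.
Context (R : realType) (d : nat).
Context (disp : measure_display) (T : measurableType disp) (P : probability T R).
Context (disp' : measure_display) (T' : measurableType disp') (Q : probability T' R).

Lemma bounded_rv_row (disp0 : measure_display) (T0 : measurableType disp0)
    (f : 'rV[R]_d -> R) (X : T0 -> 'rV[R]_d) : continuous f ->
  (exists M, forall x, `|f x| <= M) -> measurable_fun [set: T0] X ->
  bounded_rv (fun w => f (X w)).
Proof.
move=> cf [M fM] mX; split; last by exists M.
exact: measurableT_comp (continuous_row_measurable cf) mX.
Qed.

Lemma trig_poly_continuous (g : 'rV[R]_d -> R) : trig_poly g -> continuous g.
Proof.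
have cdot (theta : 'rV[R]_d) := @dotp_continuous R d theta.
elim=> [a|a|f h _ cf _ ch|c f _ cf] x.
- exact: continuous_comp (cdot a x) (@continuous_cos R _).
- exact: continuous_comp (cdot a x) (@continuous_sin R _).
- exact: cvgD (cf x) (ch x).
- exact: cvgM (cvg_cst c) (cf x).
Qed.

Lemma trig_poly_bounded (g : 'rV[R]_d -> R) : trig_poly g -> exists M, forall x, `|g x| <= M.
Proof.
elim=> [a|a|f h _ [M fM] _ [N hN]|c f _ [M fM]].
- by exists 1 => x; exact: cos_max.
- by exists 1 => x; exact: sin_max.
- by exists (M + N) => x; apply: le_trans (ler_normD _ _) _; rewrite lerD.
- by exists (`|c| * M) => x; rewrite normrM ler_wpM2l.
Qed.

Variables (X : nat -> T -> 'rV[R]_d) (Z : T' -> 'rV[R]_d).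
Hypothesis mX : forall n, measurable_fun [set: T] (X n).
Hypothesis mZ : measurable_fun [set: T'] Z.
Hypothesis cvg_cos : forall theta,
  mean P (fun w => cos (dotp theta (X n w))) @[n --> \oo] -->
  mean Q (fun w => cos (dotp theta (Z w))).
Hypothesis cvg_sin : forall theta,
  mean P (fun w => sin (dotp theta (X n w))) @[n --> \oo] -->
  mean Q (fun w => sin (dotp theta (Z w))).
Hypothesis tight : forall (i : 'I_d) (e : R), 0 < e ->
  exists2 L, 0 <= L & forall n, mean P (fun w => tail L (X n w ord0 i)) <= e.

Lemma cvg_trig_poly (g : 'rV[R]_d -> R) : trig_poly g ->
  mean P (fun w => g (X n w)) @[n --> \oo] --> mean Q (fun w => g (Z w)).
Proof.
move=> tg; elim: tg (tg) => [a|a|f h tf IF th IH|c f tf IF] _.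
- exact: cvg_cos.
- exact: cvg_sin.
- have bf := trig_poly_bounded tf; have bh := trig_poly_bounded th.
  have cf := trig_poly_continuous tf; have ch := trig_poly_continuous th.
  rewrite meanD; [|exact: bounded_rv_row|exact: bounded_rv_row].
  under eq_fun do (rewrite meanD; [|exact: bounded_rv_row|exact: bounded_rv_row]).
  by apply: cvgD; [exact: IF|exact: IH].
- have bf := trig_poly_bounded tf; have cf := trig_poly_continuous tf.
  rewrite meanZ; [|exact: bounded_rv_row].
  under eq_fun do (rewrite meanZ; [|exact: bounded_rv_row]).
  by apply: cvgM; [exact: cvg_cst|exact: IF].
Qed.

Lemma coord_measurable (disp0 : measure_display) (T0 : measurableType disp0)
    (V : T0 -> 'rV[R]_d) i : measurable_fun [set: T0] V ->
  measurable_fun [set: T0] (fun w => V w ord0 i).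
Proof.
move=> mV; have mc := continuous_row_measurable (@coord_continuous R 1 d ord0 i).
exact: measurableT_comp mc mV.
Qed.

Lemma common_tail (e : R) : 0 < e -> exists2 L, 0 < L &
  (forall n i, mean P (fun w => tail L (X n w ord0 i)) <= e) /\
  (forall i, mean Q (fun w => tail L (Z w ord0 i)) <= e).
Proof.
move=> e0.
have /choice[L hL] (i : 'I_d) : exists L, 0 <= L /\
    (forall n, mean P (fun w => tail L (X n w ord0 i)) <= e) /\
    mean Q (fun w => tail L (Z w ord0 i)) <= e.
  have [L1 L10 h1] := tight i e0.
  have [n hn] := tail_small Q (coord_measurable i mZ) e0.
  exists (Num.max L1 n%:R); split; first by rewrite le_max L10.
  split=> [m|].
    apply: le_trans (h1 m); apply: ler_mean => [||w].
    - by apply: bounded_rv_tail; exact: coord_measurable.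
    - by apply: bounded_rv_tail; exact: coord_measurable.
    - by apply: ler_tail; rewrite le_max lexx.
  apply: le_trans hn; apply: ler_mean => [||w].
  - by apply: bounded_rv_tail; exact: coord_measurable.
  - by apply: bounded_rv_tail; exact: coord_measurable.
  - by apply: ler_tail; rewrite le_max lexx orbT.
have L0 i : 0 <= L i by case: (hL i).
have LS i : L i <= \sum_j L j + 1.
  by rewrite (bigD1 i) //= -addrA lerDl addr_ge0 // sumr_ge0.
exists (\sum_j L j + 1); first by rewrite ltr_wpDl // sumr_ge0.
split=> [n i|i]; have [_ [h1 h2]] := hL i.
  apply: le_trans (h1 n); apply: ler_mean => [||w].
  - by apply: bounded_rv_tail; exact: coord_measurable.
  - by apply: bounded_rv_tail; exact: coord_measurable.
  - exact: ler_tail.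
apply: le_trans h2; apply: ler_mean => [||w].
- by apply: bounded_rv_tail; exact: coord_measurable.
- by apply: bounded_rv_tail; exact: coord_measurable.
- exact: ler_tail.
Qed.

Lemma mean_approx (disp0 : measure_display) (T0 : measurableType disp0)
    (P0 : probability T0 R) (V : T0 -> 'rV[R]_d) (f g : 'rV[R]_d -> R) (M L e e' : R) :
  measurable_fun [set: T0] V -> continuous f -> continuous g ->
  (forall x, `|f x| <= M) -> (forall x, `|g x| <= M) -> 0 <= e ->
  (forall x : 'rV[R]_d, (forall i, `|x ord0 i| <= L) -> `|f x - g x| <= e) ->
  (forall i, mean P0 (fun w => tail L (V w ord0 i)) <= e') ->
  `|mean P0 (fun w => f (V w)) - mean P0 (fun w => g (V w))| <= e + 2 * M * (d%:R * e').
Proof.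
move=> mV cf cg fM gM e0 fg ht.
have M0 : 0 <= M := le_trans (normr_ge0 _) (fM 0).
have bf : bounded_rv (fun w => f (V w)) by apply: bounded_rv_row => //; exists M.
have bg : bounded_rv (fun w => g (V w)) by apply: bounded_rv_row => //; exists M.
have bt i : bounded_rv (fun w => tail L (V w ord0 i)).
  by apply: bounded_rv_tail; exact: coord_measurable.
have bS : bounded_rv (fun w => \sum_i tail L (V w ord0 i)).
  by apply: bounded_rv_sum => i; exact: bt.
pose B w := e + 2 * M * \sum_i tail L (V w ord0 i).
have bB : bounded_rv B.
  by apply: bounded_rvD; [exact: bounded_rv_cst|exact: bounded_rvZ].
have key w : `|f (V w) - g (V w)| <= B w.
  have S0 : 0 <= \sum_i tail L (V w ord0 i) by apply: sumr_ge0 => i _; exact: tail_ge0.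
  case: (pselect (forall i, `|V w ord0 i| <= L)) => [box|].
    by apply: le_trans (fg _ box) _; rewrite lerDl !mulr_ge0.
  move=> /existsNP[i /negP]; rewrite -ltNge => Li.
  apply: (@le_trans _ _ (2 * M)).
    by apply: le_trans (ler_normB _ _) _; have := fM (V w); have := gM (V w); lra.
  rewrite ler_wpDl // ler_peMr ?mulr_ge0 // (bigD1 i) //= {1}/tail (ltW Li) lerDl.
  by apply: sumr_ge0 => j _; exact: tail_ge0.
have mB : mean P0 B <= e + 2 * M * (d%:R * e').
  rewrite /B meanD; [|exact: bounded_rv_cst|exact: bounded_rvZ].
  rewrite mean_cst meanZ // mean_sum // lerD2l ler_wpM2l ?mulr_ge0 //.
  apply: (@le_trans _ _ (\sum_(i < d) e')); first by apply: ler_sum => i _; exact: ht.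
  by rewrite big_const_ord iter_addr_0 mulr_natl.
rewrite -meanB //; apply: le_trans mB; rewrite ler_norml; apply/andP; split.
  rewrite lerNl -mulN1r -meanZ; last exact: bounded_rvB.
  apply: ler_mean => // [|w]; first by apply: bounded_rvZ; exact: bounded_rvB.
  by rewrite mulN1r; apply: le_trans (key w); rewrite -normrN ler_norm.
apply: ler_mean => // [|w]; first exact: bounded_rvB.
exact: le_trans (ler_norm _) (key w).
Qed.

(** Trigonometric polynomials are finite combinations of characteristic functions,
    and by [mean_approx] they replace a bounded continuous function up to e / 3. *)
Theorem cvg_in_distribution_charfun : cvg_in_distribution P Q X Z.
Proof.
split=> // f cf [M fM]; apply/cvgrPdist_le => e e0.
have M0 : 0 <= M := le_trans (normr_ge0 _) (fM 0).
have e40 : 0 < e / 6 by rewrite divr_gt0.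
have D0 : 0 < 2 * M * d%:R + 1 by rewrite ltr_wpDl // !mulr_ge0.
pose e' := e / 6 / (2 * M * d%:R + 1).
have e'0 : 0 < e' by rewrite divr_gt0.
have [L L0 [hP hQ]] := common_tail e'0.
have [g [tg gM fg]] := trig_approx cf fM L0 e40.
have cg := trig_poly_continuous tg.
have small : e / 6 + 2 * M * (d%:R * e') <= e / 3.
  have : 2 * M * d%:R * e' <= e / 6.
    by rewrite /e' mulrCA ler_piMr ?(ltW e40) // ler_pdivrMr // mul1r lerDl.
  by rewrite [2 * M * (_ * _)]mulrA; lra.
have e30 : 0 < e / 3 by rewrite divr_gt0.
have /cvgrPdist_le/(_ _ e30) := cvg_trig_poly tg.
apply: filterS => n hn.
have hX := le_trans (mean_approx (mX n) cf cg fM gM (ltW e40) fg (hP n)) small.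
have hZ := le_trans (mean_approx mZ cf cg fM gM (ltW e40) fg hQ) small.
change (`|mean Q (fun w => f (Z w)) - mean P (fun w => f (X n w))| <= e).
rewrite (_ : _ - _ = (mean Q (fun w => f (Z w)) - mean Q (fun w => g (Z w)))
   + (mean Q (fun w => g (Z w)) - mean P (fun w => g (X n w)))
   - (mean P (fun w => f (X n w)) - mean P (fun w => g (X n w)))); last by ring.
apply: le_trans (ler_normB _ _) _; have := ler_normD
  (mean Q (fun w => f (Z w)) - mean Q (fun w => g (Z w)))
  (mean Q (fun w => g (Z w)) - mean P (fun w => g (X n w))).
by move: hX hZ hn; lra.
Qed.

End ContinuityTheorem.

Lemma expRN_lipschitz (R : realType) (x y : R) : 0 <= x -> 0 <= y ->
  `|expR (- x) - expR (- y)| <= `|x - y|.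
Proof.
have half (u v : R) : 0 <= u -> u <= v -> `|expR (- u) - expR (- v)| <= `|u - v|.
  move=> u0 uv; rewrite distrC [in leRHS]distrC ler0_norm; last first.
    by rewrite subr_le0 ler_expR lerN2.
  rewrite opprB ger0_norm ?subr_ge0 //.
  have -> : expR (- v) = expR (- u) * expR (- (v - u)) by rewrite -expRD; congr expR; ring.
  rewrite -[X in X - _]mulr1 -mulrBr.
  have h : 1 - expR (- (v - u)) <= v - u by have := expR_ge1Dx (- (v - u)); lra.
  apply: le_trans h; rewrite ler_piMl // ?subr_ge0 ?expR_le1 ?oppr_le0 //.
  by rewrite subr_ge0.
move=> x0 y0; case: (leP x y) => [xy|/ltW yx]; first exact: half.
by rewrite distrC [in leRHS]distrC; exact: half.
Qed.

(** * Convergence of the rescaled swim *)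

Section Convergence.
Context (R : realType) (d : nat) (alpha p t : R).
Hypothesis alpha0 : 0 < alpha.
Hypothesis p01 : 0 < p < 1.
Hypothesis alphap : p * alpha < 1.
Hypothesis t0 : 0 <= t.
Context (disp : measure_display) (T : measurableType disp) (P : probability T R).
Variables (xi : nat -> {RV P >-> 'rV[R]_d}) (coin : nat -> {RV P >-> bool}).
Variables (U : nat -> {RV P >-> nat}) (Y : nat -> {RV P >-> 'rV[R]_d}).
Hypothesis hswim : shark_random_swim alpha p xi coin U Y.
Local Notation mean := (mean P).

Let steps n := Num.truncn (t * n%:R).
Let X n w := n%:R^-1 `^ alpha^-1 *: swim_position Y (steps n) w.
Local Notation c := (swim_const alpha p).
Local Notation energy := (cluster_sum (fun k => k%:R `^ alpha)).

Let steps_le n : (steps n)%:R <= t * n%:R.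
Proof. by rewrite truncn_le // mulr_ge0. Qed.

Let steps_gt n : t * n%:R < (steps n)%:R + 1.
Proof. by have := truncnS_gt (t * n%:R); rewrite natr1. Qed.

Lemma swim_const_ge0 : 0 <= c.
Proof.
rewrite swim_constE //; apply: limr_ge; first exact: freq_sum_cvg.
apply: nearW => K; apply: sumr_ge0 => k _; rewrite mulr_ge0 ?powR_ge0 //.
by case/andP: (cluster_freq_bound p01 k).
Qed.

Lemma scaled_swim_measurable n : measurable_fun [set: T] (X n).
Proof.
apply: row_measurable => i.
have -> : (fun w => X n w ord0 i) = (fun w => n%:R^-1 `^ alpha^-1 *
    \sum_(j <- index_iota 1 (steps n).+1) Y j w ord0 i).
  apply/funext => w; rewrite /X mxE /swim_position summxE.
  by [].
apply: measurable_funM => //; apply: measurable_sum => j.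
by apply: coord_measurable; exact: measurable_funPT.
Qed.

Lemma scaled_swim_charfun (theta : 'rV[R]_d) n m : steps n = m.+1 ->
  mean (fun w => cos (dotp theta (X n w))) =
    swim_mean p m (fun r => expR (- (enorm theta `^ alpha * (energy r / n%:R)))) /\
  mean (fun w => sin (dotp theta (X n w))) = 0.
Proof.
move=> sn; set z := n%:R^-1 `^ alpha^-1.
have E w : dotp theta (X n w) = dotp (z *: theta) (swim_position Y m.+1 w).
  by rewrite dotpZr dotpZl sn.
have [hc hs] := swim_charfun p01 alpha0 hswim (z *: theta) m.
split; last by rewrite -hs; congr (Rintegral _ _ _); apply/funext => w; rewrite E.
under eq_fun do rewrite E.
rewrite hc; apply: eq_swim_mean => // r _; congr (expR (- _)).
rewrite enormZ ger0_norm ?powR_ge0 // powRM ?powR_ge0 ?sqrtr_ge0 //.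
by rewrite /z -powRrM mulVf ?lt0r_neq0 // powRr1 ?invr_ge0 //; ring.
Qed.

Lemma scaled_swim_at0 (theta : 'rV[R]_d) n w : steps n = 0%N -> dotp theta (X n w) = 0.
Proof.
move=> sn; rewrite /X sn /swim_position big_geq //.
by rewrite scaler0 dotp0r.
Qed.

Lemma energy_ge0 r : 0 <= energy r.
Proof. by apply: cluster_sum_ge0 => k _; exact: powR_ge0. Qed.

(** 1 - exp(- u) <= u and the linear growth of the mean energy give the modulus
    C t s^alpha required by [tight_of_cos]. *)
Lemma scaled_swim_tight (i : 'I_d) (e : R) : 0 < e ->
  exists2 L, 0 <= L & forall n, mean (fun w => tail L (X n w ord0 i)) <= e.
Proof.
have [C C0 hC] := swim_moment_le p01 alpha0 alphap.
apply: (tight_of_cos alpha0 (mulr_ge0 C0 t0)) => [n|n s /andP[s0 s1]].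
  by apply: coord_measurable; exact: scaled_swim_measurable.
have -> : (fun w => cos (s * X n w ord0 i)) =
    (fun w => cos (dotp (s *: delta_mx ord0 i) (X n w))).
  by apply/funext => w; rewrite dotpZl dotp_delta.
have S0 : 0 <= s `^ alpha by exact: powR_ge0.
case sn : (steps n) => [|m].
  under eq_fun do rewrite scaled_swim_at0 // cos0.
  by rewrite mean_cst subrr !mulr_ge0.
rewrite (scaled_swim_charfun _ sn).1 -[X in X - _](swim_mean_cst p01 m).
rewrite -mulN1r -swim_meanZ // -swim_meanD //.
have nd : enorm (s *: delta_mx ord0 i : 'rV[R]_d) = s.
  rewrite enormZ (gtr0_norm s0) /enorm dotp_delta mxE !eqxx.
  by rewrite sqrtr1 mulr1.
rewrite nd.
have n0 : 0 < n%:R :> R.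
  rewrite ltr0n lt0n; apply/eqP => n0; move: sn; rewrite /steps n0 mulr0.
  by rewrite truncn0.
apply: (@le_trans _ _ (swim_mean p m (fun r => s `^ alpha / n%:R * energy r))).
  apply: ler_swim_mean => // r _.
  have := expR_ge1Dx (- (s `^ alpha * (energy r / n%:R))).
  rewrite (_ : s `^ alpha / n%:R * energy r = s `^ alpha * (energy r / n%:R)); last by ring.
  move: (s `^ alpha * _) => u; lra.
rewrite swim_meanZ //; apply: le_trans (ler_wpM2l _ (hC m)) _; first by rewrite divr_ge0.
rewrite -sn [leRHS]mulrC -[leLHS]mulrA; apply: ler_wpM2l => //.
by rewrite mulrC ler_pdivrMr // -mulrA ler_wpM2l.
Qed.

(** With m steps, |energy / n - c t| <= |energy - c m| / n + c |m - t n| / n, and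
    the last term is at most c / n. *)
Lemma scaled_swim_cos_cvg (theta : 'rV[R]_d) :
  mean (fun w => cos (dotp theta (X n w))) @[n --> \oo] -->
  expR (- (c * (t * enorm theta `^ alpha))).
Proof.
set s := enorm theta `^ alpha.
have s0 : 0 <= s by exact: powR_ge0.
have c0 := swim_const_ge0.
apply/cvgrPdist_le => e e0.
have D0 : 0 < s * t + 1 by rewrite ltr_wpDl // mulr_ge0.
have e1 : 0 < e / 2 / (s * t + 1) by rewrite !divr_gt0.
have [C C0 hC] := swim_lln p01 alpha0 alphap e1.
rewrite -swim_constE // in hC.
have bound n : (0 < n)%N ->
    `|expR (- (c * (t * s))) - mean (fun w => cos (dotp theta (X n w)))| <=
    e / 2 + s * (C + c) / n%:R.
  move=> n0; have nR : 0 < n%:R :> R by rewrite ltr0n.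
  have tn := steps_gt n; have tn' := steps_le n.
  (* without any step, t n < 1 and the limit is within c t s <= c s / n of 1 *)
  case sn : (steps n) => [|m].
    under [X in mean X]eq_fun do rewrite scaled_swim_at0 // cos0.
    rewrite mean_cst.
    have lip := expRN_lipschitz (mulr_ge0 c0 (mulr_ge0 t0 s0)) (lexx 0).
    rewrite oppr0 expR0 addr0 (ger0_norm (mulr_ge0 c0 (mulr_ge0 t0 s0))) in lip.
    apply: le_trans lip _.
    have h : t <= n%:R^-1.
      by rewrite -[leRHS]mul1r ler_pdivlMr //; rewrite sn mulr0n add0r in tn; exact: ltW.
    apply: ler_wpDl; first by rewrite divr_ge0 ?ltW.
    have -> : s * (C + c) / n%:R = c * (n%:R^-1 * s) + s * C / n%:R by ring.
    apply: ler_wpDr; first by rewrite divr_ge0 // mulr_ge0.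
    by apply: ler_wpM2l => //; exact: ler_wpM2r.
  rewrite (scaled_swim_charfun _ sn).1.
  rewrite -[expR (- (c * _))](swim_mean_cst p01 m).
  rewrite -[- swim_mean _ _ _]mulN1r -swim_meanZ // -swim_meanD //.
  apply: (@le_trans _ _ (swim_mean p m (fun r => s / n%:R * `|energy r - c * (size r)%:R|
     + s * c / n%:R))).
    have key r : labelling m r ->
      `|expR (- (c * (t * s))) + -1 * expR (- (s * (energy r / n%:R)))| <=
       s / n%:R * `|energy r - c * (size r)%:R| + s * c / n%:R.
      move=> /andP[/eqP sr _]; rewrite mulN1r distrC.
      apply: le_trans (expRN_lipschitz _ _) _.
      - by rewrite mulr_ge0 // divr_ge0 // energy_ge0.
      - by rewrite !mulr_ge0.
      have -> : s * (energy r / n%:R) - c * (t * s) =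
         s / n%:R * (energy r - c * (size r)%:R) + s * c / n%:R * ((size r)%:R - t * n%:R).
        by field; exact: lt0r_neq0.
      apply: le_trans (ler_normD _ _) _; rewrite normrM (ger0_norm (divr_ge0 s0 (ltW nR))).
      rewrite lerD2l normrM ger0_norm ?divr_ge0 ?mulr_ge0 // ler_piMr ?divr_ge0 ?mulr_ge0 //.
      rewrite sr -sn ler_norml; apply/andP; split; lra.
    rewrite ler_norml; apply/andP; split.
      rewrite lerNl -[- swim_mean _ _ _]mulN1r -swim_meanZ //; apply: ler_swim_mean => // r /key h.
      by apply: (le_trans _ h); move: (expR _ + _) => u; rewrite mulN1r -normrN ler_norm.
    by apply: ler_swim_mean => // r /key; apply: le_trans; exact: ler_norm.
  rewrite swim_meanD // swim_meanZ // swim_mean_cst //.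
  have h1 := ler_wpM2l (divr_ge0 s0 (ltW nR)) (hC m).
  have h2 : s / n%:R * (e / 2 / (s * t + 1) * m.+1%:R) <= e / 2.
    rewrite sn in tn'.
    apply: (@le_trans _ _ (s / n%:R * (e / 2 / (s * t + 1) * (t * n%:R)))).
      by apply: ler_wpM2l; [rewrite divr_ge0|apply: ler_wpM2l => //; exact: ltW].
    rewrite (_ : s / n%:R * _ = e / 2 * (s * t / (s * t + 1))); last first.
      by field; rewrite !lt0r_neq0.
    by rewrite ler_piMr ?divr_ge0 ?(ltW e0) // ler_pdivrMr // mul1r lerDl.
  move: h1 h2; rewrite mulrDr (_ : s * (C + c) / n%:R = s / n%:R * C + s * c / n%:R); last by ring.
  lra.
have sC0 : 0 <= s * (C + c) by rewrite mulr_ge0 // addr_ge0.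
have x0 : 0 <= s * (C + c) / (e / 2) by rewrite divr_ge0 // divr_ge0 // ltW.
exists (Num.bound (s * (C + c) / (e / 2))).+1 => // n /= hn.
have n0 : (0 < n)%N := leq_trans (ltn0Sn _) hn.
apply: le_trans (bound n n0) _; have nR : 0 < n%:R :> R by rewrite ltr0n.
have : s * (C + c) / n%:R <= e / 2.
  rewrite ler_pdivrMr // [e / 2 * _]mulrC -ler_pdivrMr ?divr_gt0 //.
  apply: ltW; apply: lt_le_trans (archi_boundP x0) _.
  by rewrite ler_nat ltnW.
by lra.
Qed.

End Convergence.

Theorem theorem2 (R : realType) (d : nat) (hd : (1 <= d)%N)
    (alpha p t : R) (halpha : 0 < alpha <= 2) (hp : 0 < p < 1)
    (halphap : alpha * p < 1) (ht : 0 <= t)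
    (disp : measure_display) (T : measurableType disp) (P : probability T R)
    (xi : nat -> {RV P >-> 'rV[R]_d}) (coin : nat -> {RV P >-> bool})
    (U : nat -> {RV P >-> nat}) (Y : nat -> {RV P >-> 'rV[R]_d})
    (hswim : shark_random_swim alpha p xi coin U Y)
    (disp' : measure_display) (T' : measurableType disp')
    (Q : probability T' R) (S : {RV Q >-> 'rV[R]_d})
    (hS : forall theta : 'rV[R]_d,
      charfun S theta =
        ((expR (- (swim_const alpha p * enorm theta `^ alpha)))%:C)%C) :
  cvg_in_distribution P Q
    (fun n w => n%:R^-1 `^ alpha^-1 *:
                swim_position Y (Num.truncn (t * n%:R)) w)
    (fun w => t `^ alpha^-1 *: S w).
Proof.
have alpha0 : 0 < alpha by case/andP: halpha.
have pa : p * alpha < 1 by rewrite mulrC.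
set z := t `^ alpha^-1.
have z0 : 0 <= z by exact: powR_ge0.
have zS theta w : dotp theta (z *: S w) = dotp (z *: theta) (S w).
  by rewrite dotpZr dotpZl.
have ES theta : mean Q (fun w => cos (dotp theta (z *: S w))) =
      expR (- (swim_const alpha p * (t * enorm theta `^ alpha))) /\
    mean Q (fun w => sin (dotp theta (z *: S w))) = 0.
  have := hS (z *: theta); rewrite /charfun enormZ (ger0_norm z0) => -[hc hs].
  split; last by rewrite -hs; congr (mean Q _); apply/funext => w; rewrite zS.
  under eq_fun do rewrite zS.
  rewrite [LHS]hc; congr (expR (- (_ * _))).
  by rewrite powRM ?sqrtr_ge0 // -powRrM mulVf ?lt0r_neq0 // powRr1.
apply: cvg_in_distribution_charfun.
- by move=> n; exact: scaled_swim_measurable.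
- apply: row_measurable => i.
  have -> : (fun w => (z *: S w) ord0 i) = (fun w => z * S w ord0 i).
    by apply/funext => w; rewrite mxE.
  apply: measurable_funM => //; apply: coord_measurable; exact: measurable_funPT.
- by move=> theta; rewrite (ES theta).1; exact: (scaled_swim_cos_cvg alpha0 hp pa ht hswim).
- move=> theta; rewrite (ES theta).2.
  rewrite (_ : (fun n => _) = fun=> 0); first exact: cvg_cst.
  apply/funext => n; case sn : (Num.truncn (t * n%:R)) => [|m].
    rewrite -[RHS](mean_cst P); congr mean; apply/funext => w.
    by rewrite /swim_position big_geq // scaler0 dotp0r sin0.
  have [_] := scaled_swim_charfun alpha0 hp hswim theta sn.
  by rewrite sn.
- move=> i e e0; exact: (scaled_swim_tight alpha0 hp pa ht hswim i e0).
Qed.
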